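(* Let $r\ge 1$ be an integer and let $G$ be a graph with $n$ vertices and rank-width at most $r$. If $r$ is odd and $n\ge \frac{13r^2-6r-3}{4r}$, then $$\Gamma_{\mathrm{CZ}}(|G\rangle)\le \frac{5r^2-1}{4r}\,n - \frac{221r^4-180r^3+10r^2+36r+9}{96r^2}.$$ If $r$ is even and $n\ge \frac{13r-6}{4}$, then $$\Gamma_{\mathrm{CZ}}(|G\rangle)\le \frac{5r}{4}\,n - \frac{221r^2-180r+100}{96}.$$
   Context: Graphs are finite, simple and undirected. The Pauli group $\mathcal{G}_n$ consists of all $\alpha h_1\otimes\dots\otimes h_n$ with $\alpha\in\{\pm1,\pm i\}$, $h_j\in\{I_2,X,Y,Z\}$. The $n$-qubit Clifford group is $\mathcal{C}_n=\{U\in U(2^n): U\mathcal{G}_nU^\dagger=\mathcal{G}_n\}$. For a graph $G=(V,E)$ with $V=\{1,\dots,n\}$, the graph state $|G\rangle$ is the $n$-qubit state (unique up to global phase) that is fixed by $X_v\otimes\bigotimes_{w\in N_G(v)}Z_w$ for all $v\in V$. States are considered up to global phase. CZ-complexity: a quantum algorithm consists of (1) measurements of qubits in the computational basis (measured qubits are discarded); (2) single-qubit Clifford operations; (3) two-qubit Clifford operations (elements of $\mathcal{C}_2$ applied to any pair of qubits); later operations may depend on earlier measurement outcomes. Its CZ-complexity is the maximum, over measurement outcomes, of the number of two-qubit Clifford operations. $\Gamma_{\mathrm{CZ}}(|G\rangle)$ is the minimum CZ-complexity of an algorithm that generates $|G\rangle$ from $|0\rangle^{\otimes(n+s)}$ with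 probability $1$ for some $s\ge0$. Rank-width: for $S\subseteq V$, $\mathrm{cutrank}_G(S)$ is the rank over $\mathbb{F}_2$ of the $S\times(V\setminus S)$ submatrix of the adjacency matrix of $G$ (zero for $S=\varnothing$). A rank-decomposition of $G$ is a pair $(T,L)$ with $T$ a tree of maximum degree at most three with at least two vertices and $L$ a bijection from $V$ to the leaves of $T$. Each edge $e$ of $T$ induces a partition $\{S,V\setminus S\}$ of $V$ (via the leaves of the two components of $T-e$); the width of $e$ is $\mathrm{cutrank}_G(S)$, and the width of $(T,L)$ is the maximum width of its edges. The rank-width of $G$ is the minimum width over all rank-decompositions (and $0$ if $G$ has at most one vertex). *)

(* Defs.v *)
From HB Require Import structures.
From mathcomp Require Import all_boot all_order all_algebra.
From mathcomp Require Import complex.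
From mathcomp Require Import boolp classical_sets reals constructive_ereal ereal.

Set Implicit Arguments.
Unset Strict Implicit.
Unset Printing Implicit Defensive.

Import Order.TTheory GRing.Theory Num.Theory.

Local Open Scope classical_set_scope.
Local Open Scope ring_scope.
Local Open Scope sesquilinear_scope.

(* The least element of P; +oo when P is empty, so that no default value
   can make an upper bound hold by accident. *)
Definition min_nat (R : realType) (P : set nat) : \bar R :=
  ereal_inf [set (k%:R)%:E | k in P].

Section Graphs.
Variable V : finType.

Record sgraph := SGraph {
  adj :> rel V;
  adj_sym : symmetric adj;
  adj_irr : irreflexive adj }.

Variable G : sgraph.

Definition degree (x : V) : nat := #|[set y | G x y]%SET|.

Definition is_tree : Prop :=
  (forall x y, connect G x y) /\
  (forall c : seq V, (2 < size c)%N -> ~ ucycle G c).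

Definition del_edge (x y : V) : rel V :=
  fun u w => G u w && ([set u; w]%SET != [set x; y]%SET).

Definition cutrank (S : {set V}) : nat :=
  \rank (\matrix_(i < #|S|, j < #|~: S|%SET)
           (G (enum_val i) (enum_val j))%:R : 'M['F_2]_(_, _)).

End Graphs.

Section RankWidth.
Variables (V : finType) (G : sgraph V).

Definition is_rank_decomposition (U : finType) (T : sgraph U) (L : V -> U) :=
  [/\ is_tree T,
      (forall x, degree T x <= 3)%N,
      (2 <= #|U|)%N,
      injective L &
      forall x, x \in codom L <-> degree T x = 1%N].

(* The side of x is taken; the cut-rank of the complementary side is the
   same, the two submatrices being transposes of each other. *)
Definition edge_width (U : finType) (T : sgraph U) (L : V -> U) (x y : U) :=
  cutrank G [set v | connect (del_edge T x y) x (L v)]%SET.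

Definition decomposition_width (U : finType) (T : sgraph U) (L : V -> U) :=
  \max_(e : U * U | T e.1 e.2) edge_width T L e.1 e.2.

Definition rankwidth (R : realType) : \bar R :=
  if (#|V| <= 1)%N then 0%:E else
  min_nat R [set k | exists (U : finType) (T : sgraph U) (L : V -> U),
    is_rank_decomposition T L /\ decomposition_width T L = k].

End RankWidth.

Section Quantum.
Variable C : numClosedFieldType.

(* Labels of the computational basis of n qubits.  Vectors and operators are
   matrices of size #|bits n| = 2 ^ n whose rows and columns are indexed by
   labels through enum_rank / enum_val. *)
Definition bits (n : nat) := {ffun 'I_n -> 'I_2}.
Definition qstate (n : nat) := 'cV[C]_#|bits n|.
Definition qop (n : nat) := 'M[C]_#|bits n|.

Definition pauliX : 'M[C]_2 := \matrix_(a, b) (a != b)%:R.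
Definition pauliZ : 'M[C]_2 := \matrix_(a, b) ((a == b)%:R * (-1) ^+ a).
Definition pauliY : 'M[C]_2 := 'i *: (pauliX *m pauliZ).

Definition tensor n (h : 'I_n -> 'M[C]_2) : qop n :=
  \matrix_(a, b) \prod_(j < n)
    h j ((enum_val a : bits n) j) ((enum_val b : bits n) j).

Definition pauli_group n : set (qop n) :=
  [set A | exists (alpha : C) (h : 'I_n -> 'M[C]_2),
     [/\ alpha \in [:: 1; - 1; 'i; - 'i],
         forall j, h j \in [:: 1%:M; pauliX; pauliY; pauliZ]
       & A = alpha *: tensor h]].

Definition clifford_group n : set (qop n) :=
  [set U | U \is unitarymx /\
     [set U *m A *m U ^t* | A in @pauli_group n] = @pauli_group n].

(* U acting on the qubits f 0, ..., f (k - 1) and as the identity on the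
   others; f is meant to be injective. *)
Definition act_on k m (f : 'I_k -> 'I_m) (U : qop k) : qop m :=
  \matrix_(a, b)
    let x : bits m := enum_val a in
    let y : bits m := enum_val b in
    if [forall j, (j \notin codom f) ==> (x j == y j)]
    then U (enum_rank ([ffun t => x (f t)] : bits k))
           (enum_rank ([ffun t => y (f t)] : bits k))
    else 0.

Definition pair_of m (i j : 'I_m) : 'I_2 -> 'I_m :=
  fun t => if t == ord0 then i else j.

Definition insert_bit m (i : 'I_m.+1) (b : 'I_2) (x : bits m) : bits m.+1 :=
  [ffun j => if unlift i j is Some j' then x j' else b].

(* Unnormalized state of the remaining qubits after measuring qubit i with
   outcome b; its squared norm is the probability of that outcome. *)
Definition measured m (i : 'I_m.+1) (b : 'I_2) (psi : qstate m.+1) : qstate m :=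
  \col_a psi (enum_rank (insert_bit i b (enum_val a))) ord0.

Definition sqnorm n (psi : qstate n) : C := \sum_a `|psi a ord0| ^+ 2.

Definition normalize n (psi : qstate n) : qstate n :=
  (sqrtC (sqnorm psi))^-1 *: psi.

Definition ket0 m : qstate m := \col_a ((enum_val a : bits m) == [ffun=> ord0])%:R.

(* Adaptive algorithms from m qubits to n qubits.  Measuring removes a qubit
   from the register, the others keep their order. *)
Inductive algorithm (n : nat) : nat -> Type :=
| Output : algorithm n n
| Measure m (i : 'I_m.+1) (next : 'I_2 -> algorithm n m) : algorithm n m.+1
| Clifford1 m (i : 'I_m) (U : qop 1) (HU : clifford_group U)
    (next : algorithm n m) : algorithm n m
| Clifford2 m (i j : 'I_m) (Hij : i != j) (U : qop 2) (HU : clifford_group U)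
    (next : algorithm n m) : algorithm n m.

(* Outcomes of probability zero are counted too.  This does not change the
   minimum over algorithms: such a branch can be replaced by one that only
   measures. *)
Fixpoint cz_complexity n m (a : algorithm n m) : nat :=
  match a with
  | Output => 0
  | Measure _ _ next => \max_(b < 2) cz_complexity (next b)
  | Clifford1 _ _ _ _ next => cz_complexity next
  | Clifford2 _ _ _ _ _ _ next => (cz_complexity next).+1
  end.

(* Probability that the normalized final state satisfies P.  The initial
   state may be unnormalized, in which case the result is weighted by its
   squared norm. *)
Fixpoint output_prob n (P : set (qstate n)) m (a : algorithm n m) :
    qstate m -> C :=
  match a in algorithm _ m0 return qstate m0 -> C with
  | Output => fun psi => if `[< P (normalize psi) >] then sqnorm psi else 0
  | Measure _ i next => fun psi =>
      \sum_(b < 2) output_prob P (next b) (measured i b psi)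
  | Clifford1 _ i U _ next => fun psi =>
      output_prob P next (act_on (fun _ : 'I_1 => i) U *m psi)
  | Clifford2 _ i j _ U _ next => fun psi =>
      output_prob P next (act_on (pair_of i j) U *m psi)
  end.

Definition graph_stabilizer n (G : sgraph 'I_n) (v : 'I_n) : qop n :=
  tensor (fun w => if w == v then pauliX
                   else if G v w then pauliZ else 1%:M).

(* All unit representatives of the ray |G>. *)
Definition graph_state n (G : sgraph 'I_n) : set (qstate n) :=
  [set psi | sqnorm psi = 1 /\
     forall v, graph_stabilizer G v *m psi = psi].

Definition generates n s (a : algorithm n (n + s)) (G : sgraph 'I_n) : Prop :=
  output_prob (graph_state G) a (ket0 (n + s)) = 1.

End Quantum.

Definition Gamma_CZ (R : realType) n (G : sgraph 'I_n) : \bar R :=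
  min_nat R [set k | exists s (a : algorithm R[i] n (n + s)),
    generates a G /\ cz_complexity a = k].

(* Main.v *)
Require Import Defs.
From HB Require Import structures.
From mathcomp Require Import all_boot all_order all_algebra.
From mathcomp Require Import zify ring lra.

(**
Only CZ gates are charged: one-qubit Cliffords are free, no qubit is ancillary
and nothing is measured.  Modulo phases, a Clifford circuit acts on Pauli
operators by symplectic maps over F_2, and it prepares |G> from |0...0> (up to
signs, repaired by Z gates) as soon as its inverse maps the stabilizers of |G>
to products of Z's.  So one has to bring an isotropic subspace of dimension m
on m qubits to Z-type with few CZ gates.

A stabilizer of weight w becomes a single Z with w - 1 CZ gates, and its qubit
can then be forgotten.

For small m, two qubits are removed at a time.  The stabilizers supported on
m/2 + 2 qubits form a space of dimension at least 3; averaging over its seven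
lines gives commuting p, q with wt p + wt q + wt (p + q) at most 18/7 of that
number, and clearing p and q jointly, each CZ gate lowers this sum by 2.  Two
qubits thus cost at most (2m + 1)/3 gates, which sums to (m^2 + 3m - 4)/6.

For larger m, the rank-decomposition has a side S with r + t active qubits,
0 < t <= r, and cut-rank at most r.  By a Singleton-type count the stabilizers
supported on S have small weights, and t qubits of S are removed with
r t + t^2/4 gates.  The quadratic bound lies below the linear one exactly on
an interval [n0, n0 + r], where n0 is the threshold of the theorem, so blocks
are removed until m falls into it.
*)

Set Implicit Arguments.
Unset Strict Implicit.
Unset Printing Implicit Defensive.

Import Order.TTheory GRing.Theory Num.Theory.

(** * Edge cuts of a rank-decomposition *)

(** The obstacle is to keep the cut-rank bound usable once qubits have been removed. It is carried
    as an inequality: every side has at most [r] more active qubits than independent stabilizers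
    supported on it. Rooting the tree at a leaf and using only the sides away from the root makes
    the sides laminar. A block of t qubits removed inside one side then either misses another side,
    or lies in it and lowers its active qubits by t and its dimension by at most t, or leaves it
    with at most [r] active qubits.

    The slope sigma of the linear bound is the cost per qubit of a full block t = r, namely (r^2 +
    floor(r^2/4))/r; this is where the parity of r enters. The window has length r because a block
    of at most r qubits cannot jump over it. Slope and length fix the rest: the chord of (m^2 + 3m -
    4)/6 of slope sigma over an interval of length r starts at n0 = (6 sigma - 3 - r)/2, and its
    intercept -c is given by n0 (n0 + r) = 6c - 4. *)

Lemma connect_invariant (U : finType) (e : rel U) (P : U -> Prop) x u :
  (forall a b, e a b -> P a -> P b) -> connect e x u -> P x -> P u.
Proof.
move=> step /connectP[p pp ->]; elim: p x pp => [|z p IH] x //= /andP[exz pp] Px.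
by apply: IH pp _; exact: step exz Px.
Qed.

Section Trees.
Variables (U : finType) (T : sgraph U).
Hypothesis treeT : is_tree T.
Implicit Types (x y z u w : U).

Lemma set2_eqE (a b c d : U) :
  ([set a; b] == [set c; d])%SET = (a == c) && (b == d) || (a == d) && (b == c).
Proof.
apply/eqP/orP=> [e|[]/andP[/eqP-> /eqP->] //]; last by rewrite setUC.
have /set2P[ac|ad] : a \in [set c; d]%SET by rewrite -e set21.
  have /set2P[da|db] : d \in [set a; b]%SET by rewrite e set22.
    have /set2P[bc|bd] : b \in [set c; d]%SET by rewrite -e set22.
      by left; rewrite ac bc da ac !eqxx.
    by left; rewrite ac bd !eqxx.
  by left; rewrite ac db !eqxx.
have /set2P[ca|cb] : c \in [set a; b]%SET by rewrite e set21.
  have /set2P[bc|bd] : b \in [set c; d]%SET by rewrite -e set22.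
    by right; rewrite ad bc !eqxx.
  by right; rewrite ad bd ca ad !eqxx.
by right; rewrite ad cb !eqxx.
Qed.

Definition side x y : {set U} := [set u | connect (del_edge T x y) x u]%SET.

Lemma del_edgeE x y u w : del_edge T x y u w =
  T u w && ~~ ((u == x) && (w == y) || (u == y) && (w == x)).
Proof. by rewrite /del_edge set2_eqE. Qed.

Lemma del_edge_sym x y : symmetric (del_edge T x y).
Proof.
by move=> u w; rewrite !del_edgeE (@adj_sym _ T) orbC ![(w == _) && _]andbC.
Qed.

Lemma del_edgeC x y u w : del_edge T x y u w = del_edge T y x u w.
Proof. by rewrite !del_edgeE orbC. Qed.

Lemma connect_del_sym x y : connect_sym (del_edge T x y).
Proof. by apply: sym_connect_sym; exact: del_edge_sym. Qed.

Lemma mem_side x y : x \in side x y.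
Proof. by rewrite inE connect0. Qed.

Lemma side_closed x y u w : T u w -> u \in side x y ->
  ~~ ((u == x) && (w == y) || (u == y) && (w == x)) -> w \in side x y.
Proof.
move=> Tuw; rewrite !inE => xu h; apply: connect_trans xu (connect1 _).
by rewrite del_edgeE Tuw.
Qed.

(** A path from [x] to [y] avoiding the edge between them, made simple, would close up with that
    edge to a cycle. *)
Lemma sideN x y : T x y -> y \notin side x y.
Proof.
move=> Txy; rewrite inE; apply/negP=> /connectP[p0 pp0 ey].
move: ey; case: (shortenP pp0) => p pp up _ ey {p0 pp0}.
have Tp : path T x p by apply: sub_path pp => u w; rewrite del_edgeE => /andP[].
have [_ /(_ (x :: p))] := treeT; apply.
  (* [is_tree] only forbids cycles on more than two vertices: an empty path would make the edge a
     loop, and a single step would be the deleted edge itself. *)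
  case: p pp ey {up Tp} => [|z [|z' p]] //=.
    by move=> _ e; move: Txy; rewrite e adj_irr.
  by rewrite andbT del_edgeE => /andP[_]; move=> h e; move: h; rewrite e !eqxx.
by rewrite /ucycle up andbT /= rcons_path Tp -ey adj_sym.
Qed.

Lemma side_cover x y u : T x y -> (u \in side x y) || (u \in side y x).
Proof.
move=> Txy; have [/(_ x u) cxu _] := treeT.
apply: (connect_invariant (P := fun a => (a \in side x y) || (a \in side y x))) cxu _;
  last by rewrite mem_side.
move=> a b Tab; case: (boolP ((a == x) && (b == y) || (a == y) && (b == x))) => [e _|ne].
  by case/orP: e => /andP[_ /eqP ->]; rewrite mem_side ?orbT.
case/orP=> h; first by rewrite (side_closed Tab h ne).
by rewrite (side_closed Tab h) ?orbT // orbC.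
Qed.

Lemma side_disjoint x y u : T x y -> u \in side x y -> u \notin side y x.
Proof.
move=> Txy; rewrite !inE => xu; apply/negP; rewrite -(eq_connect (del_edgeC x y)) => yu.
have := sideN Txy; rewrite inE; case/negP; apply: connect_trans xu _.
by rewrite connect_del_sym.
Qed.

Lemma sideC x y u : T x y -> (u \notin side x y) = (u \in side y x).
Proof.
move=> Txy; apply/idP/idP => [h|h].
  by have := side_cover u Txy; rewrite (negbTE h).
by apply: (side_disjoint _ h); rewrite adj_sym.
Qed.

(** The component of [x] never meets [x'], so deleting an edge at [x'] leaves it connected. *)
Lemma side_connect x y x' y' u : x' \notin side x y -> u \in side x y ->
  connect (del_edge T x' y') x u.
Proof.
move=> x'S; rewrite inE => xu.
suff [] : u \in side x y /\ connect (del_edge T x' y') x u by [].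
apply: (connect_invariant (P := fun a => a \in side x y /\ connect (del_edge T x' y') x a)) xu _;
  last by rewrite mem_side connect0.
move=> a b Dab [aS xa]; have bS : b \in side x y.
  by move: aS; rewrite !inE => /connect_trans; apply; exact: connect1.
split=> //; apply: connect_trans xa (connect1 _); rewrite del_edgeE.
have := Dab; rewrite {1}del_edgeE => /andP[-> _] /=.
by apply/negP=> /orP[]/andP[/eqP ea /eqP eb]; move: x'S; rewrite -?ea -?eb ?aS ?bS.
Qed.

Lemma side_edge x y x' y' : T x' y' ->
  ~~ ((x' == x) && (y' == y) || (x' == y) && (y' == x)) ->
  (x' \in side x y) = (y' \in side x y).
Proof.
move=> Txy' ne; apply/idP/idP => h; first exact: side_closed Txy' h ne.
by apply: side_closed h _; [rewrite adj_sym | rewrite orbC ![(y' == _) && _]andbC].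
Qed.

(** With the tree rooted at [rho], [x] is the lower end of the edge and [side x y] is the subtree
    hanging from it. *)
Definition away rho x y := T x y /\ rho \notin side x y.

Lemma side_laminar_outside x y x' y' : x' \notin side x y ->
  [disjoint side x y & side x' y'] \/ side x y \subset side x' y'.
Proof.
move=> x'S; case: (boolP (x \in side x' y')) => xS'.
  right; apply/subsetP=> u uS; have := side_connect y' x'S uS.
  by rewrite !inE in xS' *; exact: connect_trans.
left; apply/pred0P=> u /=; apply/negbTE/negP=> /andP[uS uS'].
case/negP: xS'; move: uS'; rewrite !inE => uS'; apply: connect_trans uS' _.
rewrite connect_del_sym; exact: (side_connect y' x'S uS).
Qed.

Lemma side_laminar rho x y x' y' : away rho x y -> away rho x' y' ->
  [\/ [disjoint side x y & side x' y'], side x y \subset side x' y'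
    | side x' y' \subset side x y].
Proof.
move=> [Txy rS] [Txy' rS'].
case: (boolP ((x' == x) && (y' == y) || (x' == y) && (y' == x))) => [|ne].
  case/orP=> /andP[/eqP ex /eqP ey]; first by constructor 2; rewrite ex ey.
  by have := rS; rewrite sideC // -ex -ey (negbTE rS').
have ne' : ~~ ((x == x') && (y == y') || (x == y') && (y == x')).
  by rewrite ![x == _]eq_sym ![y == _]eq_sym [X in _ || X]andbC.
case: (boolP (x' \in side x y)) => x'S; last first.
  by case: (side_laminar_outside y' x'S); [constructor 1 | constructor 2].
case: (boolP (x \in side x' y')) => xS'; last first.
  case: (side_laminar_outside y xS'); last by constructor 3.
  by rewrite disjoint_sym; constructor 1.
(* Each side contains the lower end of the other edge. Then [rho] is joined to [y] without the edge
   between [x'] and [y'], hence lies in [side x' y'], a contradiction. *)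
have yS' : y \in side x' y' by rewrite -(side_edge Txy ne').
have x'C : x' \notin side y x by rewrite -sideC ?negbK.
have rC : rho \in side y x by rewrite -sideC.
have yr := side_connect y' x'C rC.
by case/negP: rS'; move: yS'; rewrite !inE => yS'; exact: connect_trans yr.
Qed.

Section Children.
Variables (x y : U).
Hypothesis Txy : T x y.

Let child z := T x z && (z != y).

Lemma side_child_sub z : child z -> side z x \subset side x y.
Proof.
move=> /andP[Txz zy]; have Tzx : T z x by rewrite adj_sym.
apply/subsetP=> u uS; have := side_connect y (sideN Tzx) uS.
rewrite inE; apply: connect_trans; apply: connect1; rewrite del_edgeE Txz eqxx (negbTE zy) /=.
by apply/negP=> /andP[/eqP e _]; move: Txy; rewrite e adj_irr.
Qed.

(** The first step of a simple path from [x] leads to a child [z]; the rest avoids [x], hence the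
    edge between [z] and [x]. *)
Lemma side_child_cover u : u \in side x y -> u != x -> exists2 z, child z & u \in side z x.
Proof.
rewrite inE => /connectP[p0 pp0 ->]; case: (shortenP pp0) => p pp up _ {p0 pp0}.
case: p pp up => [|z p] /=; first by rewrite eqxx.
move=> /andP[exz pp] /andP[xp up] _; exists z.
  rewrite /child; move: exz; rewrite del_edgeE eqxx /= => /andP[->] /=.
  by rewrite negb_or => /andP[].
rewrite inE; apply/connectP; exists p => //.
apply: (sub_in_path (P := predC1 x)) pp; last first.
  by apply/allP=> a; apply: contraTneq => ->.
move=> a b; rewrite !inE => ax bx; rewrite !del_edgeE => /andP[-> _] /=.
by rewrite (negbTE ax) (negbTE bx) andbF.
Qed.

End Children.

Lemma card_bigcup_le (I V : finType) (P : pred I) (F : I -> {set V}) m :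
  (forall i, P i -> #|F i| <= m) -> #|\bigcup_(i | P i) F i| <= #|P| * m.
Proof.
move=> h; rewrite -sum_nat_const; apply: (@leq_trans (\sum_(i | P i) #|F i|)).
  elim/big_rec2: _ => [|i a b _ ab]; first by rewrite cards0.
  by apply: leq_trans (leq_card_setU _ _) _; rewrite leq_add2l.
exact: leq_sum.
Qed.

Variables (V : finType) (L : V -> U).
Hypothesis deg3 : forall x, degree T x <= 3.
Hypothesis L_inj : injective L.
Hypothesis leafP : forall x, x \in codom L <-> degree T x = 1.

Definition cut x y : {set V} := [set v | connect (del_edge T x y) x (L v)]%SET.

Lemma mem_cut v x y : (v \in cut x y) = (L v \in side x y).
Proof. by rewrite !inE. Qed.

Lemma cut_laminar rho x y x' y' : away rho x y -> away rho x' y' ->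
  [\/ [disjoint cut x y & cut x' y'], cut x y \subset cut x' y'
    | cut x' y' \subset cut x y].
Proof.
move=> axy axy'; case: (side_laminar axy axy') => h.
- constructor 1; apply/pred0P=> v /=; rewrite !mem_cut.
  by case: (boolP (L v \in side x y)) => // /(disjointFr h).
- by constructor 2; apply/subsetP=> v; rewrite !mem_cut; exact: (subsetP h).
- by constructor 3; apply/subsetP=> v; rewrite !mem_cut; exact: (subsetP h).
Qed.

(** Walk down the tree as long as some child subtree holds more than [r] elements of [A]. Where the
    walk stops, degree three leaves at most two children, with at most [r] elements each. *)
Lemma side_balanced rho r (A : {set V}) x y : 0 < r -> away rho x y ->
  r < #|cut x y :&: A| ->
  exists x' y', away rho x' y' /\ r < #|cut x' y' :&: A| <= 2 * r.
Proof.
move=> r0; move: {2}#|side x y| (leqnn #|side x y|) => k.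
elim: k x y => [|k IH] x y hk [Txy rS] hr.
  by move: hk; rewrite leqn0 cards_eq0 => /eqP e; have := mem_side x y; rewrite e inE.
have [small|big] := leqP #|cut x y :&: A| (2 * r); first by exists x, y; rewrite hr.
pose child z := T x z && (z != y).
case: (pickP (fun z => child z && (r < #|cut z x :&: A|))) => [z /andP[cz rz]|no].
  have sub := side_child_sub Txy cz.
  have Tzx : T z x by move: cz => /andP[]; rewrite adj_sym.
  apply: (IH z x) => //; last first.
    by split=> //; apply: contra rS; exact: (subsetP sub).
  rewrite -ltnS; apply: leq_trans hk; apply: proper_card; apply/properP; split=> //.
  by exists x; [exact: mem_side | exact: sideN].
have cardN : #|child| < degree T x.
  rewrite /degree (cardsD1 y) inE Txy add1n ltnS; apply: subset_leq_card.
  by apply/subsetP=> z /andP[Txz zy]; rewrite !inE zy.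
have sub : cut x y :&: A \subset [set v | L v == x]%SET :|: \bigcup_(z | child z) (cut z x :&: A).
  apply/subsetP=> v; rewrite in_setI !inE => /andP[vS vA].
  have vS' : L v \in side x y by rewrite inE.
  case: (eqVneq (L v) x) => //= vx; have [z cz zv] := side_child_cover vS' vx.
  apply/bigcupP; exists z => //; by rewrite in_setI vA andbT mem_cut.
have le1 : #|[set v | L v == x]%SET| <= 1.
  apply/card_le1P=> v; rewrite inE => /eqP vx w; rewrite inE -vx; apply/eqP/idP => [/L_inj -> |/eqP -> //].
  by rewrite inE.
have leN : #|\bigcup_(z | child z) (cut z x :&: A)| <= #|child| * r.
  apply: card_bigcup_le => z cz; have := no z; rewrite cz /= => /negbT; by rewrite -leqNgt.
have tot := leq_trans (subset_leq_card sub) (leq_card_setU _ _).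
(* A leaf has no children, so its side holds one vertex at most, too few as [r] is positive; an
   inner node carries no vertex of the graph itself. *)
case: (boolP (x \in codom L)) => [/leafP deg1|xL].
  move: tot le1 leN hr; rewrite deg1 ltnS leqn0 in cardN; rewrite (eqP cardN) mul0n.
  move: r0; clear; lia.
have e0 : #|[set v | L v == x]%SET| = 0.
  apply/eqP; rewrite cards_eq0; apply/eqP/setP=> v; rewrite !inE; apply/negP=> /eqP e.
  by case/negP: xL; rewrite -e codom_f.
move: tot leN big; rewrite e0 add0n.
have : #|child| * r <= 2 * r by rewrite leq_mul2r -ltnS (leq_trans cardN (deg3 x)) orbT.
clear; lia.
Qed.

(** The starting edge of the descent: with the root at the leaf of [v0], everything else hangs from
    its only edge. *)
Lemma leaf_cut v0 : exists z, away (L v0) z (L v0) /\ setT :\ v0 \subset cut z (L v0).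
Proof.
have : L v0 \in codom L by exact: codom_f.
move/leafP => deg1; have /cards1P[z hz] : #|[set y | T (L v0) y]%SET| == 1 by rewrite -deg1.
have Tz : T (L v0) z by have := set11 z; rewrite -hz inE.
have Tz' : T z (L v0) by rewrite adj_sym.
exists z; split; first by split=> //; exact: sideN.
apply/subsetP=> v; rewrite in_setD1 => /andP[vv0 _]; rewrite mem_cut.
apply: contraNT vv0; rewrite sideC // => vS; apply/eqP; apply: L_inj.
apply/eqP; apply: contraT => ne.
have [w /andP[Tw wz] _] := side_child_cover vS ne.
by case/negP: wz; have : w \in [set z]%SET by [rewrite -hz inE]; rewrite inE.
Qed.

End Trees.

(** * Pauli operators modulo phase and Clifford circuits *)

Local Open Scope ring_scope.

Lemma F2P (x : 'F_2) : x = 0 \/ x = 1.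
Proof. by case: x => [[|[|//]] i]; [left | right]; apply: val_inj. Qed.

Lemma F2xx (x : 'F_2) : x + x = 0.
Proof. by case: (F2P x) => ->; apply: val_inj. Qed.

Lemma I2P (i : 'I_2) : i = 0 \/ i = 1.
Proof. by case: i => [[|[|//]] i]; [left | right]; apply: val_inj. Qed.

Section Paulis.
Variable n : nat.

(* Modulo phase; p 0 v and p 1 v are the exponents of X_v and Z_v. *)
Definition pauli := 'M['F_2]_(2, n).

Definition mkp (x z : 'I_n -> 'F_2) : pauli :=
  \matrix_(i, v) (if i == 0 then x v else z v).

Lemma mkp0 x z v : mkp x z 0 v = x v. Proof. by rewrite mxE. Qed.
Lemma mkp1 x z v : mkp x z 1 v = z v. Proof. by rewrite mxE. Qed.

Lemma pauliP (p q : pauli) :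
  (forall v, p 0 v = q 0 v /\ p 1 v = q 1 v) -> p = q.
Proof.
by move=> h; apply/matrixP=> i v; case: (I2P i) => ->; case: (h v).
Qed.

Definition nz (p : pauli) v := (p 0 v != 0) || (p 1 v != 0).
Definition supp (p : pauli) : {set 'I_n} := [set v | nz p v].

Lemma nzE p v : nz p v = false -> p 0 v = 0 /\ p 1 v = 0.
Proof. by move/negbT; rewrite negb_or !negbK => /andP[/eqP-> /eqP->]. Qed.

Lemma suppPn p v : v \notin supp p -> p 0 v = 0 /\ p 1 v = 0.
Proof. by rewrite inE => /negbTE; exact: nzE. Qed.

Lemma supp_eq0 p : (supp p == set0) = (p == 0).
Proof.
apply/eqP/eqP=> [h|->]; last by apply/setP=> v; rewrite !inE /nz !mxE eqxx.
apply: pauliP => v; rewrite !mxE; apply: suppPn; by rewrite h inE.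
Qed.

Definition erase_fun (E : {set 'I_n}) (p : pauli) : pauli :=
  mkp (fun v => if v \in E then 0 else p 0 v)
      (fun v => if v \in E then 0 else p 1 v).

Lemma erase_fun_is_linear E : linear (erase_fun E).
Proof.
move=> a p q; apply: pauliP => v; rewrite !mxE /=.
by case: ifP => // _; rewrite mulr0 addr0.
Qed.
HB.instance Definition _ E :=
  GRing.isLinear.Build _ _ _ _ (erase_fun E) (erase_fun_is_linear E).

End Paulis.

(* Locked: otherwise unification unfolds the matrices over 'F_2. *)
HB.lock Definition erase n (E : {set 'I_n}) : 'End(pauli n) := linfun (@erase_fun n E).
Arguments erase {n} E.

HB.lock Definition supported n (X : {set 'I_n}) : {vspace pauli n} := lker (erase X : 'End(pauli n)).
Arguments supported {n} X.

Section Symplectic.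
Variable n : nat.
Local Notation pauli := (pauli n).

Lemma eraseE (E : {set 'I_n}) (p : pauli) i v : erase E p i v = if v \in E then 0 else p i v.
Proof. by rewrite erase.unlock lfunE /= mxE; case: (I2P i) => ->. Qed.

Lemma supportedP (X : {set 'I_n}) (p : pauli) :
  reflect (forall v, v \notin X -> p 0 v = 0 /\ p 1 v = 0) (p \in supported X).
Proof.
rewrite supported.unlock memv_ker; apply: (iffP eqP) => [h v vX|h].
  have /matrixP h' := h; move: (h' 0 v) (h' 1 v).
  by rewrite !eraseE !mxE (negbTE vX) => -> ->.
by apply: pauliP => v; rewrite !eraseE !mxE; case: ifP => // /negbT /h.
Qed.

Lemma supported_suppP (X : {set 'I_n}) (p : pauli) :
  (p \in supported X) = (supp p \subset X).
Proof.
apply/supportedP/subsetP => [h v|h v vX].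
  by rewrite inE; apply: contraTT => /h [h0 h1]; rewrite /nz h0 h1 eqxx.
by apply: suppPn; apply: contra vX => /h.
Qed.

Lemma supported_sub (X Y : {set 'I_n}) : X \subset Y -> (supported X <= supported Y)%VS.
Proof.
by move=> XY; apply/subvP => p; rewrite !supported_suppP => /subset_trans; apply.
Qed.

Lemma dim_supported_le (X : {set 'I_n}) : (\dim (supported X) <= 2 * #|X|)%N.
Proof.
pose f := linfun (colsub (fun i : 'I_#|X| => enum_val i) : pauli -> 'M['F_2]_(2, _)).
have <- : \dim (f @: supported X) = \dim (supported X).
  apply: limg_dim_eq; apply/eqP; rewrite -subv0; apply/subvP => p.
  rewrite memv_cap memv_ker memv0 lfunE => /andP[/supportedP hX /eqP/matrixP hp].
  apply/eqP/pauliP => v; rewrite !mxE; case: (boolP (v \in X)) => [vX|/hX //].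
  move: (hp 0 (enum_rank_in vX v)) (hp 1 (enum_rank_in vX v)).
  by rewrite !mxE enum_rankK_in.
by apply: leq_trans (dimvS (subvf _)) _; rewrite dimvf dim_matrix.
Qed.

(** The Singleton-type count, by rank-nullity for [erase X] on [U]: the image lives on the qubits of
    [A :\: X], each of which has two coordinates. *)
Lemma dim_cap_supported (U : {vspace pauli}) (A X : {set 'I_n}) :
  (U <= supported A)%VS ->
  (\dim U <= \dim (U :&: supported X) + 2 * #|A :\: X|)%N.
Proof.
move=> UA; rewrite -(limg_ker_dim (erase X) U) supported.unlock leq_add2l.
apply: leq_trans (dim_supported_le _); apply: dimvS; apply/subvP => _ /memv_imgP[p pU ->].
apply/supportedP => v; rewrite !eraseE inE; case: (v \in X) => //= vA.
by have /supportedP := subvP UA _ pU; apply.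
Qed.

Lemma supported_capE (U : {vspace pauli}) (A : {set 'I_n}) :
  (U <= supported A)%VS -> (U :&: supported A)%VS = U.
Proof. by move/capv_idPl. Qed.

(** The symplectic form: it vanishes exactly when the two Pauli operators commute. *)
Definition omega (p q : pauli) : 'F_2 :=
  \sum_v (p 0 v * q 1 v + p 1 v * q 0 v).

Definition isotropic (U : {vspace pauli}) :=
  forall p q, p \in U -> q \in U -> omega p q = 0.

Definition had_fun (u : 'I_n) (p : pauli) : pauli :=
  mkp (fun v => if v == u then p 1 v else p 0 v)
      (fun v => if v == u then p 0 v else p 1 v).
Definition phase_fun (u : 'I_n) (p : pauli) : pauli :=
  mkp (fun v => p 0 v) (fun v => if v == u then p 1 v + p 0 v else p 1 v).
Definition cz_fun (u w : 'I_n) (p : pauli) : pauli :=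
  mkp (fun v => p 0 v)
      (fun v => if v == u then p 1 v + p 0 w
                else if v == w then p 1 v + p 0 u else p 1 v).

Lemma had_fun_is_linear u : linear (had_fun u).
Proof. by move=> a p q; apply: pauliP => v; rewrite !mxE /=; case: ifP. Qed.
HB.instance Definition _ u :=
  GRing.isLinear.Build _ _ _ _ (had_fun u) (had_fun_is_linear u).

Lemma phase_fun_is_linear u : linear (phase_fun u).
Proof.
move=> a p q; apply: pauliP => v; rewrite !mxE /=; split=> //.
by case: ifP => // _; ring.
Qed.
HB.instance Definition _ u :=
  GRing.isLinear.Build _ _ _ _ (phase_fun u) (phase_fun_is_linear u).

Lemma cz_fun_is_linear u w : linear (cz_fun u w).
Proof.
move=> a p q; apply: pauliP => v; rewrite !mxE /=; split=> //.
by do 2?case: ifP => // _; ring.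
Qed.
HB.instance Definition _ u w :=
  GRing.isLinear.Build _ _ _ _ (cz_fun u w) (cz_fun_is_linear u w).

End Symplectic.

HB.lock Definition had n (u : 'I_n) : 'End(pauli n) := linfun (had_fun u).
HB.lock Definition phase n (u : 'I_n) : 'End(pauli n) := linfun (phase_fun u).
HB.lock Definition cz n (u w : 'I_n) : 'End(pauli n) := linfun (cz_fun u w).
Arguments had {n} u.
Arguments phase {n} u.
Arguments cz {n} u w.

Section Circuits.
Variable n : nat.
Local Notation pauli := (pauli n).

Lemma had0 u (p : pauli) v : had u p 0 v = if v == u then p 1 v else p 0 v.
Proof. by rewrite had.unlock lfunE mkp0. Qed.
Lemma had1 u (p : pauli) v : had u p 1 v = if v == u then p 0 v else p 1 v.
Proof. by rewrite had.unlock lfunE mkp1. Qed.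
Lemma phase0 u (p : pauli) v : phase u p 0 v = p 0 v.
Proof. by rewrite phase.unlock lfunE mkp0. Qed.
Lemma phase1 u (p : pauli) v : phase u p 1 v = if v == u then p 1 v + p 0 v else p 1 v.
Proof. by rewrite phase.unlock lfunE mkp1. Qed.
Lemma cz0 u w (p : pauli) v : cz u w p 0 v = p 0 v.
Proof. by rewrite cz.unlock lfunE mkp0. Qed.
Lemma cz1 u w (p : pauli) v :
  cz u w p 1 v = if v == u then p 1 v + p 0 w
                 else if v == w then p 1 v + p 0 u else p 1 v.
Proof. by rewrite cz.unlock lfunE mkp1. Qed.

Definition gateE := (had0, had1, phase0, phase1, cz0, cz1).

Lemma hadK u (p : pauli) : had u (had u p) = p.
Proof. by apply: pauliP => v; rewrite !gateE; case: eqP. Qed.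

Lemma phaseK u (p : pauli) : phase u (phase u p) = p.
Proof.
by apply: pauliP => v; rewrite !gateE; case: eqP; rewrite // -addrA F2xx addr0.
Qed.

Lemma czK u w (p : pauli) : cz u w (cz u w p) = p.
Proof.
apply: pauliP => v; rewrite !gateE.
by do 2?[case: eqP => _]; rewrite // -addrA F2xx addr0.
Qed.

Lemma omega_had u (p q : pauli) : omega (had u p) (had u q) = omega p q.
Proof.
by apply: eq_bigr => v _; rewrite !gateE; case: eqP => // _; ring.
Qed.

Lemma omega_phase u (p q : pauli) : omega (phase u p) (phase u q) = omega p q.
Proof.
apply: eq_bigr => v _; rewrite !gateE; case: eqP => // _.
by rewrite mulrDr mulrDl addrACA F2xx addr0.
Qed.

Lemma omega_cz u w (p q : pauli) : u != w -> omega (cz u w p) (cz u w q) = omega p q.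
Proof.
move=> uw; rewrite /omega (bigD1 u) // (bigD1 w) 1?eq_sym //=.
rewrite [in RHS](bigD1 u) // [in RHS](bigD1 w) 1?eq_sym //= !addrA.
congr (_ + _); last first.
  by apply: eq_bigr => v /andP[/negbTE vu /negbTE vw]; rewrite !gateE vu vw.
rewrite !gateE !eqxx eq_sym (negbTE uw).
(* In characteristic 2 the additional terms [a * y] and [x * c] cancel, each occurring twice. *)
have e (a b c d x y s t : 'F_2) :
    a * (d + y) + (b + x) * c + x * (t + c) + (s + a) * y =
    a * d + b * c + x * t + s * y.
  rewrite -[RHS]addr0 -[X in _ = _ + X]addr0 -{1}(F2xx (a * y)) -(F2xx (x * c)).
  by ring.
exact: e.
Qed.

(* f is the action on Pauli operators of a circuit on the qubits of A with k CZ
   gates; each constructor adds a gate that acts before f. *)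
Inductive circuit (A : {set 'I_n}) : nat -> 'End(pauli) -> Prop :=
| circuit_id : circuit A 0 \1%VF
| circuit_had k f u : u \in A -> circuit A k f -> circuit A k (f \o had u)%VF
| circuit_phase k f u : u \in A -> circuit A k f -> circuit A k (f \o phase u)%VF
| circuit_cz k f u w : u \in A -> w \in A -> u != w -> circuit A k f ->
    circuit A k.+1 (f \o cz u w)%VF.

Section CircuitTheory.
Implicit Types (A X : {set 'I_n}) (f : 'End(pauli)) (p q : pauli).

Lemma circuit_comp A k l f g :
  circuit A k f -> circuit A l g -> circuit A (k + l) (g \o f)%VF.
Proof.
move=> cf cg; elim: cf => [|{}k {}f u uA _ IH|{}k {}f u uA _ IH|{}k {}f u w uA wA uw _ IH];
  rewrite ?comp_lfun1r ?comp_lfunA //;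
  by [apply: circuit_had|apply: circuit_phase|apply: circuit_cz].
Qed.

Lemma circuit_sub A X k f : A \subset X -> circuit A k f -> circuit X k f.
Proof.
move=> /subsetP AX; elim=> [|{}k {}f u uA _|{}k {}f u uA _|{}k {}f u w uA wA uw _]; first exact: circuit_id.
- by apply: circuit_had; exact: AX.
- by apply: circuit_phase; exact: AX.
- by apply: circuit_cz => //; exact: AX.
Qed.

Lemma circuit_omega A k f p q : circuit A k f -> omega (f p) (f q) = omega p q.
Proof.
move=> cf; elim: cf p q => [|{}k {}f u _ _ IH|{}k {}f u _ _ IH|{}k {}f u w _ _ uw _ IH] p q;
  by rewrite ?id_lfunE // !comp_lfunE IH ?omega_had ?omega_phase ?omega_cz.
Qed.

Lemma circuit_inj A k f : circuit A k f -> injective f.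
Proof.
elim => [|{}k {}f u _ _ IH|{}k {}f u _ _ IH|{}k {}f u w _ _ uw _ IH] p q; rewrite ?id_lfunE ?comp_lfunE //.
- by move/IH/(congr1 (had u)); rewrite !hadK.
- by move/IH/(congr1 (phase u)); rewrite !phaseK.
- by move/IH/(congr1 (cz u w)); rewrite !czK.
Qed.

Lemma circuit_out A k f p v :
  circuit A k f -> v \notin A -> f p 0 v = p 0 v /\ f p 1 v = p 1 v.
Proof.
move=> cf vA; have nv u : u \in A -> (v == u) = false.
  by move=> uA; apply/negbTE; apply: contraNneq vA => ->.
elim: cf p => [|{}k {}f u uA _ IH|{}k {}f u uA _ IH|{}k {}f u w uA wA uw _ IH] p;
  rewrite ?id_lfunE // comp_lfunE !(IH _).1 !(IH _).2 !gateE ?nv //.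
Qed.

Lemma circuit_fix A k f p :
  circuit A k f -> {in A, forall v, p 0 v = 0 /\ p 1 v = 0} -> f p = p.
Proof.
move=> cf hp; elim: cf => [|{}k {}f u uA _ IH|{}k {}f u uA _ IH|{}k {}f u w uA wA uw _ IH];
  rewrite ?id_lfunE // comp_lfunE.
- suff -> : had u p = p by [].
  apply: pauliP => v; rewrite !gateE.
  by case: eqP => // ->; have [-> ->] := hp u uA.
- suff -> : phase u p = p by [].
  apply: pauliP => v; rewrite !gateE.
  by case: eqP => // ->; have [-> ->] := hp u uA; rewrite addr0.
- suff -> : cz u w p = p by [].
  apply: pauliP => v; rewrite !gateE.
  have [-> _] := hp u uA; have [-> _] := hp w wA.
  by rewrite addr0 !if_same.
Qed.

Lemma circuit_supported A X k f p :
  circuit A k f -> A \subset X -> p \in supported X -> f p \in supported X.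
Proof.
move=> cf /subsetP AX /supportedP pX; apply/supportedP => v vX.
have vA : v \notin A by apply: contra vX => /AX.
by have [-> ->] := circuit_out p cf vA; exact: pX.
Qed.

End CircuitTheory.

End Circuits.

(** * Reducing a single Pauli operator to one Z *)

Section Shrink.
Variable n : nat.
Local Notation pauli := (pauli n).
Implicit Types (p q : pauli) (A S X : {set 'I_n}).

(* The one-qubit Cliffords realize SL(2, F_2) on the local Paulis. *)
Lemma local_basis (v : 'I_n) (a0 a1 b0 b1 : 'F_2) : a0 * b1 + a1 * b0 = 1 ->
  exists2 g, circuit [set v] 0 g & forall p x y,
    p 0 v = x * a0 + y * b0 -> p 1 v = x * a1 + y * b1 ->
    g p 0 v = x /\ g p 1 v = y.
Proof.
have vv : v \in [set v] by rewrite inE.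
have I := circuit_id [set v].
case: (F2P a0) => ->; case: (F2P a1) => ->; case: (F2P b0) => ->; case: (F2P b1) => -> // _.
- exists (\1 \o had v)%VF; first exact: circuit_had.
  move=> p x y h0 h1; rewrite !comp_lfunE !id_lfunE !gateE !eqxx h0 h1.
  by rewrite !mulr0 !mulr1 addr0 add0r.
- exists ((\1 \o had v) \o phase v)%VF; first by do 2?constructor.
  move=> p x y h0 h1; rewrite !comp_lfunE !id_lfunE !gateE !eqxx h0 h1.
  by rewrite !mulr0 !mulr1 add0r -addrA F2xx addr0.
- exists \1%VF => // p x y h0 h1; rewrite !id_lfunE h0 h1.
  by rewrite !mulr0 !mulr1 addr0 add0r.
- exists ((\1 \o had v) \o phase v \o had v)%VF; first by do 3?constructor.
  move=> p x y h0 h1; rewrite !comp_lfunE !id_lfunE !gateE !eqxx h0 h1.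
  by rewrite !mulr0 !mulr1 add0r -addrA F2xx addr0.
- exists (\1 \o phase v)%VF; first by do 1?constructor.
  move=> p x y h0 h1; rewrite !comp_lfunE !id_lfunE !gateE !eqxx h0 h1.
  by rewrite !mulr0 !mulr1 !addr0 addrC addrA F2xx add0r.
- exists ((\1 \o phase v) \o had v)%VF; first by do 2?constructor.
  move=> p x y h0 h1; rewrite !comp_lfunE !id_lfunE !gateE !eqxx h0 h1.
  by rewrite !mulr0 !mulr1 !addr0 addrC addrA F2xx add0r.
Qed.

Definition loc p v : 'F_2 * 'F_2 := (p 0 v, p 1 v).

(** The symplectic form on one qubit; the value 1 means that [a] and [b] anticommute, equivalently
    that they form a basis of the plane over F_2. *)
Definition sym (a b : 'F_2 * 'F_2) : 'F_2 := a.1 * b.2 + a.2 * b.1.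

Definition lc (x y : 'F_2) (a b : 'F_2 * 'F_2) : 'F_2 * 'F_2 :=
  (x * a.1 + y * b.1, x * a.2 + y * b.2).

Lemma local_sym v a b : sym a b = 1 ->
  exists2 g, circuit [set v] 0 g & forall p x y,
    loc p v = lc x y a b -> loc (g p) v = (x, y).
Proof.
move=> /(local_basis v)[g cg hg]; exists g => // p x y [h0 h1].
by rewrite /loc; have [-> ->] := hg p x y h0 h1.
Qed.

Lemma nz_loc p v : nz p v = (loc p v != (0, 0)).
Proof. by rewrite /nz /loc xpair_eqE negb_and. Qed.

Lemma locD p q v : loc (p + q) v = (p 0 v + q 0 v, p 1 v + q 1 v).
Proof. by rewrite /loc !mxE. Qed.

Lemma loc_out A k f p v : circuit A k f -> v \notin A -> loc (f p) v = loc p v.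
Proof. by move=> cf vA; rewrite /loc; have [-> ->] := circuit_out p cf vA. Qed.

Lemma F2_pairP (a : 'F_2 * 'F_2) :
  [\/ a = (0, 0), a = (0, 1), a = (1, 0) | a = (1, 1)].
Proof.
case: a => x y; case: (F2P x) => ->; case: (F2P y) => ->;
 by [constructor 1|constructor 2|constructor 3|constructor 4].
Qed.

Lemma sym_partner a : a != (0, 0) -> exists b, sym b a = 1.
Proof.
case: (F2_pairP a) => -> // _.
- by exists (1, 0); apply: val_inj.
- by exists (0, 1); apply: val_inj.
- by exists (0, 1); apply: val_inj.
Qed.

Lemma symC a b : sym a b = sym b a.
Proof. by rewrite /sym addrC ![_ * b.1]mulrC ![_ * b.2]mulrC. Qed.

(** Complete [c] to a basis and send it to Z. The term [lc 0 e c c] is just e times c, so several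
    operators that are multiples of the same [c] are treated at once. *)
Lemma local_Z v c : c != (0, 0) ->
  exists2 g, circuit [set v] 0 g & forall p e,
    loc p v = lc 0 e c c -> loc (g p) v = (0, e).
Proof.
move=> /sym_partner[b /(local_sym v)[g cg hg]]; exists g => // p e h.
by apply: hg; rewrite h /lc !mul0r.
Qed.

Lemma local_X v c : c != (0, 0) ->
  exists2 g, circuit [set v] 0 g & forall p e,
    loc p v = lc 0 e c c -> loc (g p) v = (e, 0).
Proof.
move=> /sym_partner[b]; rewrite symC => /(local_sym v)[g cg hg]; exists g => // p e h.
by apply: hg; rewrite h /lc !mul0r add0r addr0 addr0 add0r.
Qed.

Lemma lc11 c d : lc 1 1 c d = (c.1 + d.1, c.2 + d.2).
Proof. by rewrite /lc !mul1r. Qed.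
Lemma lc10 c d : lc 1 0 c d = c.
Proof. by case: c => a b; rewrite /lc !mul0r !mul1r !addr0. Qed.
Lemma lc01 c d : lc 0 1 c d = d.
Proof. by case: d => a b; rewrite /lc !mul0r !mul1r !add0r. Qed.

(** The common move of all reductions: after free one-qubit gates, a CZ gate adds the X part of each
    qubit to the Z part of the other. Only the choice of [gu] and [gw] varies. *)
Lemma cz_step S u w gu gw : u \in S -> w \in S -> u != w ->
  circuit [set u] 0 gu -> circuit [set w] 0 gw ->
  exists f, [/\ circuit S 1 f,
    forall p v, v != u -> v != w -> loc (f p) v = loc p v,
    forall p, loc (f p) u = ((loc (gu p) u).1, (loc (gu p) u).2 + (loc (gw p) w).1) &
    forall p, loc (f p) w = ((loc (gw p) w).1, (loc (gw p) w).2 + (loc (gu p) u).1)].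
Proof.
move=> uS wS uw cu cw.
have nuw : u \notin [set w] by rewrite inE.
have nwu : w \notin [set u] by rewrite inE eq_sym.
(* [gu p - p] vanishes at [w], so [gw] fixes it, and by linearity the order of the two local gates
   does not matter at [w]. *)
have gwu p : loc (gw (gu p)) w = loc (gw p) w.
  have e0 : gu p = p + (gu p - p) by rewrite addrC subrK.
  have fx : gw (gu p - p) = gu p - p.
    apply: (circuit_fix cw) => v; rewrite inE => /eqP->; rewrite !mxE.
    by have [-> ->] := circuit_out p cu nwu; rewrite !subrr.
  rewrite {1}e0 linearD /= fx /loc !mxE.
  by have [-> ->] := circuit_out p cu nwu; rewrite !subrr !addr0.
exists (\1 \o cz u w \o (gw \o gu))%VF; split.
- apply: (circuit_comp (k := 0) (l := 1)).
    apply: (circuit_comp (k := 0) (l := 0)).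
      by apply: circuit_sub cu; rewrite sub1set.
    by apply: circuit_sub cw; rewrite sub1set.
  by apply: circuit_cz => //; exact: circuit_id.
- move=> p v vu vw; rewrite !comp_lfunE id_lfunE /loc !gateE (negbTE vu) (negbTE vw).
  have vu' : v \notin [set u] by rewrite inE.
  have vw' : v \notin [set w] by rewrite inE.
  have [-> ->] := circuit_out (gu p) cw vw'.
  by have [-> ->] := circuit_out p cu vu'.
- move=> p; rewrite !comp_lfunE id_lfunE {1}/loc !gateE eqxx.
  have [-> ->] := circuit_out (gu p) cw nuw.
  by have := gwu p; rewrite /loc => -[-> _].
- move=> p; rewrite !comp_lfunE id_lfunE {1}/loc !gateE eqxx eq_sym (negbTE uw).
  have [-> _] := circuit_out (gu p) cw nuw.
  by have := gwu p; rewrite /loc => -[-> ->].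
Qed.

Definition Zon (E : {set 'I_n}) p :=
  forall v, p 0 v = 0 /\ (v \notin E -> p 1 v = 0).

(** Turn two qubits of the support into X and Z; a CZ gate maps X tensor Z to X tensor I, so each
    gate takes one qubit out of the support. *)
Lemma shrink_single S p k : p != 0 -> supp p \subset S -> (#|supp p| <= k.+1)%N ->
  exists l f a, [/\ circuit S l f, (l <= k)%N, a \in S & Zon [set a] (f p)].
Proof.
elim: k p => [|k IH] p p0 pS hk.
  have /cards1P[a ha] : #|supp p| == 1%N.
    by rewrite eqn_leq hk card_gt0 supp_eq0.
  have aS : a \in S by apply: (subsetP pS); rewrite ha inE.
  have pa : loc p a != (0, 0).
    by rewrite -nz_loc; have : a \in supp p by [rewrite ha inE]; rewrite inE.
  have [g cg hg] := local_Z a pa.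
  exists 0%N, g, a; split=> //; first by apply: circuit_sub cg; rewrite sub1set.
  move=> v; case: (eqVneq v a) => [->|va].
    by have := hg p 1; rewrite lc01 => /(_ erefl) [-> _]; rewrite inE eqxx.
  have va' : v \notin [set a] by rewrite inE.
  have [-> ->] := circuit_out p cg va'.
  have vs : v \notin supp p by rewrite ha.
  by have [-> ->] := suppPn vs.
case: (leqP #|supp p| k.+1) => [le|gt].
  have [l [f [a [cf lk aS zf]]]] := IH p p0 pS le.
  by exists l, f, a; split=> //; exact: leqW.
have /card_gt1P[u [w [up wp uw]]] : (1 < #|supp p|)%N by lia.
have [uS wS] : u \in S /\ w \in S by split; apply: (subsetP pS).
have pu : loc p u != (0, 0) by move: up; rewrite inE nz_loc.
have pw : loc p w != (0, 0) by move: wp; rewrite inE nz_loc.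
have [gu cu hu] := local_X u pu; have [gw cw hw] := local_Z w pw.
have [f [cf fo fu fw]] := cz_step uS wS uw cu cw.
have eu := hu p 1 (esym (lc01 _ _)); have ew := hw p 1 (esym (lc01 _ _)).
have fpw : loc (f p) w = (0, 0) by rewrite fw eu ew /= F2xx.
have sub : supp (f p) \subset supp p :\ w.
  apply/subsetP => v; rewrite !inE !nz_loc; case: (eqVneq v w) => [->|vw] /=.
    by rewrite fpw eqxx.
  case: (eqVneq v u) => [->|vu]; [ by rewrite pu | rewrite ?fo // ].
have fp0 : f p != 0.
  by apply: contraNneq p0 => e; rewrite -(inj_eq (circuit_inj cf)) e linear0.
have [l [f' [a [cf' lk aS zf]]]] : exists l f' a, [/\ circuit S l f', (l <= k)%N, a \in S & Zon [set a] (f' (f p))].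
  apply: IH => //; first by apply: subset_trans sub _; apply: subset_trans (subsetDl _ _) _.
  by apply: leq_trans (subset_leq_card sub) _; rewrite (cardsD1 w) wp in hk.
exists l.+1, (f' \o f)%VF, a; split=> //; last by move=> v; rewrite comp_lfunE.
exact: (circuit_comp (k := 1)).
Qed.

End Shrink.

(** * Clearing a pair of commuting Pauli operators *)

Definition ind (a : 'F_2 * 'F_2) : 'F_2 := (a != (0, 0))%:R.

(** In the plane over F_2 a vanishing symplectic form means linear dependence; [c] spans the common
    line. *)
Lemma rank1P (a b : 'F_2 * 'F_2) : sym a b = 0 -> (a != (0, 0)) || (b != (0, 0)) ->
  exists c, [/\ c != (0, 0), a = lc 0 (ind a) c c & b = lc 0 (ind b) c c].
Proof.
move=> /eqP h ab; exists (if a == (0, 0) then b else a).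
by move: h ab; case: (F2_pairP a) => ->; case: (F2_pairP b) => -> // _ _; split => //; apply/eqP.
Qed.

Lemma ind_nz (a : 'F_2 * 'F_2) : ((ind a, 0 : 'F_2) != (0, 0)) = (a != (0, 0)).
Proof. by rewrite /ind; case: (a != _). Qed.

Lemma star_neq0 (a b : 'F_2 * 'F_2) : sym a b = 1 -> (a != (0, 0)) && (b != (0, 0)).
Proof. by move/eqP; case: (F2_pairP a) => ->; case: (F2_pairP b) => ->. Qed.

(** The number of non-trivial operators among [a], [b] and [a + b]: 3 at an anticommuting coordinate
    (a star), 2 at a non-trivial commuting one, 0 elsewhere. *)
Definition mval (a b : 'F_2 * 'F_2) : nat :=
  ((a != (0, 0)%R) + (b != (0, 0)%R) + (a != b))%N.

Lemma mval_star (a b : 'F_2 * 'F_2) : sym a b = 1 -> mval a b = 3.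
Proof. by move/eqP; case: (F2_pairP a) => ->; case: (F2_pairP b) => ->. Qed.

Lemma mval_rank1 (a b : 'F_2 * 'F_2) : sym a b = 0 -> (a != (0, 0)) || (b != (0, 0)) -> mval a b = 2.
Proof. by move/eqP; case: (F2_pairP a) => ->; case: (F2_pairP b) => ->. Qed.
(** At a star the X parts of the two operators can be prescribed as any non-zero pair [(e, d)]. A CZ
    gate from a star can therefore cancel any commuting coordinate, and the star stays a star. *)
Lemma star_basis (a b : 'F_2 * 'F_2) (e d : 'F_2) : sym a b = 1 -> (e != 0) || (d != 0) ->
  exists al be y z, [/\ sym al be = 1, a = lc e y al be, b = lc d z al be &
    sym (e, y) (d, z) = 1].
Proof.
move=> h; case: (F2P e) => ->; case: (F2P d) => -> // _.
- exists b, a, 1, 0; rewrite lc01 lc10 symC; split=> //; exact/eqP.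
- exists a, b, 0, 1; rewrite lc01 lc10; split=> //; exact/eqP.
- exists a, (a.1 + b.1, a.2 + b.2), 0, 1; rewrite lc10 lc11 /=; split=> //; last exact/eqP.
    rewrite -[RHS]h /sym /= !mulrDr addrACA [a.1 * a.2]mulrC F2xx add0r //.
  by rewrite !addrA !F2xx !add0r; case: (b).
Qed.

Section Pair.
Variable n : nat.
Local Notation pauli := (pauli n).
Implicit Types (p q : pauli) (A S X : {set 'I_n}).

Definition sgn p q v := sym (loc p v) (loc q v).

Lemma omegaE p q : omega p q = \sum_v sgn p q v. Proof. by []. Qed.

Lemma loc0_supp p v : (v \in supp p) = (loc p v != (0, 0)).
Proof. by rewrite inE nz_loc. Qed.

Definition pair_cleared S k p q := exists l f a b,
  [/\ circuit S l f, (l <= k)%N, [/\ a \in S, b \in S & a != b],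
      Zon [set a; b] (f p) & Zon [set a; b] (f q)].

Lemma pair_cleared_le S k l p q : (k <= l)%N ->
  pair_cleared S k p q -> pair_cleared S l p q.
Proof.
move=> kl [l' [f [a [b [cf lk ab hp hq]]]]]; exists l', f, a, b; split=> //.
exact: leq_trans lk kl.
Qed.

Lemma pair_cleared_step S k l f p q : circuit S l f ->
  pair_cleared S k (f p) (f q) -> pair_cleared S (l + k) p q.
Proof.
move=> cf [l' [f' [a [b [cf' lk ab hp hq]]]]]; exists (l + l')%N, (f' \o f)%VF, a, b.
split=> //; rewrite ?comp_lfunE //; first exact: circuit_comp.
by rewrite leq_add2l.
Qed.

Lemma local_Z2 p q v : sgn p q v = 0 ->
  exists2 g, circuit [set v] 0 g & g p 0 v = 0 /\ g q 0 v = 0.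
Proof.
move=> h; case: (boolP ((loc p v != (0, 0)) || (loc q v != (0, 0)))) => nz.
  have [c [c0 pc qc]] := rank1P h nz.
  have [g cg hg] := local_Z v c0; exists g => //.
  by have [-> _] := hg p _ pc; have [-> _] := hg q _ qc.
move: nz; rewrite negb_or !negbK => /andP[/eqP[p0 _] /eqP[q0 _]].
by exists \1%VF; [exact: circuit_id | rewrite !id_lfunE].
Qed.

(** On locally commuting coordinates one-qubit gates alone make both operators Z-type. *)
Lemma pair_cleared0 S a b p q : a \in S -> b \in S -> a != b ->
  (forall v, sgn p q v = 0) ->
  supp p \subset [set a; b] -> supp q \subset [set a; b] ->
  pair_cleared S 0 p q.
Proof.
move=> aS bS ab ns sp sq.
have [g cg [gp gq]] := local_Z2 (ns a).
have ba : b \notin [set a] by rewrite inE eq_sym.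
have : sgn (g p) (g q) b = 0 by rewrite /sgn !(loc_out _ cg ba); exact: ns.
move=> /local_Z2[h ch [hp hq]].
exists 0%N, (h \o g)%VF, a, b; split=> //.
- apply: (circuit_comp (k := 0) (l := 0)).
    by apply: circuit_sub cg; rewrite sub1set.
  by apply: circuit_sub ch; rewrite sub1set.
- have nab : a \notin [set b] by rewrite inE.
  move=> v; rewrite comp_lfunE; case: (eqVneq v b) => [->|vb].
    by rewrite hp !inE eqxx orbT.
  have vb' : v \notin [set b] by rewrite inE.
  have [-> ->] := circuit_out (g p) ch vb'.
  case: (eqVneq v a) => [->|va]; first by rewrite gp !inE eqxx.
  have va' : v \notin [set a] by rewrite inE.
  have [-> ->] := circuit_out p cg va'.
  have : v \notin supp p by apply: contra (subsetP sp v) _; rewrite !inE negb_or va.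
  by move/suppPn => [-> ->].
- have nab : a \notin [set b] by rewrite inE.
  move=> v; rewrite comp_lfunE; case: (eqVneq v b) => [->|vb].
    by rewrite hq !inE eqxx orbT.
  have vb' : v \notin [set b] by rewrite inE.
  have [-> ->] := circuit_out (g q) ch vb'.
  case: (eqVneq v a) => [->|va]; first by rewrite gq !inE eqxx.
  have va' : v \notin [set a] by rewrite inE.
  have [-> ->] := circuit_out q cg va'.
  have : v \notin supp q by apply: contra (subsetP sq v) _; rewrite !inE negb_or va.
  by move/suppPn => [-> ->].
Qed.

Definition typ p q v : bool * bool := (loc p v != (0, 0), loc q v != (0, 0)).

Lemma typ_nz p q v : (typ p q v != (false, false)) =
  (loc p v != (0, 0)) || (loc q v != (0, 0)).
Proof. by rewrite /typ; case: (loc p v != _); case: (loc q v != _). Qed.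

(** When the same operators of the pair act at [a] and at [w], rotating to X at [a] and Z at [w]
    gives equal coefficients, so one CZ gate cancels [w] for both. *)
Lemma merge_types S p q a w : a \in S -> w \in S -> a != w ->
  sgn p q a = 0 -> sgn p q w = 0 -> typ p q a = typ p q w ->
  typ p q a != (false, false) ->
  exists f, [/\ circuit S 1 f,
    forall p v, v != a -> v != w -> loc (f p) v = loc p v,
    loc (f p) w = (0, 0) /\ loc (f q) w = (0, 0) &
    loc (f p) a = (ind (loc p a), 0) /\ loc (f q) a = (ind (loc q a), 0)].
Proof.
move=> aS wS aw sa sw [tp tq]; rewrite typ_nz => na.
have nw : (loc p w != (0, 0)) || (loc q w != (0, 0)) by rewrite -tp -tq.
have [c [c0 pc qc]] := rank1P sa na; have [d [d0 pd qd]] := rank1P sw nw.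
have [gu cu hu] := local_X a c0; have [gw cw hw] := local_Z w d0.
have [f [cf fo fu fw]] := cz_step aS wS aw cu cw.
exists f; split=> //; rewrite ?fu ?fw (hu p _ pc) (hu q _ qc) (hw p _ pd) (hw q _ qd) /=.
  by rewrite /ind tp tq !F2xx.
by rewrite !addr0.
Qed.

(** Only three types of non-trivial coordinates exist, so merging equal types loses one qubit per
    gate until two qubits remain or the three types occur once each. The latter case needs two
    gates, which accounts for the bound of one less than the size of the union. *)
Lemma pair_cleared_nostar k S p q :
  (forall v, sgn p q v = 0) -> supp p :|: supp q \subset S ->
  (1 < #|supp p :|: supp q| <= k.+1)%N -> pair_cleared S k p q.
Proof.
elim: k p q => [|k IH] p q ns sub; first by case/andP=> /leq_trans h /h.
case/andP=> U1 Uk; set U := supp p :|: supp q in sub U1 Uk.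
have tU v : (v \in U) = (typ p q v != (false, false)).
  by rewrite inE !loc0_supp typ_nz.
have [U2|U2] := leqP #|U| 2.
  have /cards2P[a [b [ab Uab]]] : #|U| == 2%N by rewrite eqn_leq U2.
  apply: (@pair_cleared_le _ 0) => //.
  have aU : a \in U by rewrite Uab !inE eqxx.
  have bU : b \in U by rewrite Uab !inE eqxx orbT.
  apply: (@pair_cleared0 _ a b) => //; try exact: (subsetP sub).
    by rewrite -Uab; exact: subsetUl.
  by rewrite -Uab; exact: subsetUr.
case: (leqP #|U| k.+1) => [Uk'|kU].
  by apply: (pair_cleared_le (leqnSn k)); apply: IH => //; rewrite U1.
have [[a [w [aU wU aw taw]]]|inj] :
    (exists a w, [/\ a \in U, w \in U, a != w & typ p q a = typ p q w]) \/
    {in U &, injective (typ p q)}.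
  case: (boolP [exists a in U, exists w in U, (a != w) && (typ p q a == typ p q w)]).
    case/existsP=> a /andP[aU /existsP[w /andP[wU /andP[aw /eqP taw]]]].
    by left; exists a, w.
  move=> h; right=> a w aU wU taw; apply: contraNeq h => aw.
  apply/existsP; exists a; rewrite aU /=; apply/existsP; exists w.
  by rewrite wU aw taw eqxx.
- have aS := subsetP sub _ aU; have wS := subsetP sub _ wU.
  move: (aU); rewrite tU => ta.
  have [f [cf fo [fpw fqw] [fpa fqa]]] := merge_types aS wS aw (ns a) (ns w) taw ta.
  apply: (pair_cleared_step cf (k := k)).
  have E : supp (f p) :|: supp (f q) = U :\ w.
    apply/setP=> v; rewrite in_setD1 tU typ_nz in_setU !loc0_supp.
    case: (eqVneq v w) => [->|vw] /=; first by rewrite fpw fqw eqxx.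
    case: (eqVneq v a) => [->|va]; last by rewrite !fo.
    by rewrite fpa fqa !ind_nz.
  apply: IH.
  + move=> v; rewrite /sgn; case: (eqVneq v w) => [->|vw].
      by rewrite fpw fqw /sym mulr0 addr0.
    case: (eqVneq v a) => [->|va]; last by rewrite !fo //; exact: ns.
    by rewrite fpa fqa /sym /= mulr0 mul0r addr0.
  + by rewrite E; apply: subset_trans sub; exact: subsetDl.
  + rewrite E; have := cardsD1 w U; rewrite wU => e.
    by move: U2 Uk; rewrite e; move: #|_ :\ _| => x; clear; lia.
(* Three qubits of pairwise distinct types. A CZ gate between [a], where only [p] acts, and [w],
   where both act, removes [p] from [w]; then [w] has the type of [b] and merges with it. *)
- have im : typ p q @: U = [set (true, false); (false, true); (true, true)].
    apply/eqP; rewrite eqEcard card_in_imset // (leq_trans _ U2); last first.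
      by rewrite setUC cardsU1 cards2 !inE.
    rewrite andbT; apply/subsetP=> _ /imsetP[v vU ->]; rewrite !inE.
    by move: vU; rewrite tU; case: (typ p q v) => [[] []].
  have [a aU ta] : exists2 a, a \in U & typ p q a = (true, false).
    by have /imsetP[a aU ->] : (true, false) \in typ p q @: U; [rewrite im !inE|exists a].
  have [b bU tb] : exists2 b, b \in U & typ p q b = (false, true).
    by have /imsetP[b bU ->] : (false, true) \in typ p q @: U; [rewrite im !inE|exists b].
  have [w wU tw] : exists2 w, w \in U & typ p q w = (true, true).
    by have /imsetP[w wU ->] : (true, true) \in typ p q @: U; [rewrite im !inE|exists w].
  have ab : a != b by apply/negP=> /eqP e; move: ta; rewrite e tb.
  have aw : a != w by apply/negP=> /eqP e; move: ta; rewrite e tw.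
  have bw : b != w by apply/negP=> /eqP e; move: tb; rewrite e tw.
  have UE : U = [set a; b; w].
    apply/eqP; rewrite eq_sym eqEcard; apply/andP; split.
      by apply/subsetP=> v; rewrite in_setU in_set2 in_set1 -orbA => /or3P[]/eqP->.
    by rewrite -(card_in_imset inj) im !(setUC [set _; _]) !cardsU1 !cards1 !inE ab ![w == _]eq_sym (negbTE aw) (negbTE bw).
  have [aS bS wS] := And3 (subsetP sub _ aU) (subsetP sub _ bU) (subsetP sub _ wU).
  have k1 : (1 <= k)%N by have := leq_trans U2 Uk; rewrite !ltnS.
  case: ta => pa /negbFE/eqP qa; case: tb => /negbFE/eqP pb qb; case: tw => pw qw.
  have na : (loc p a != (0, 0)) || (loc q a != (0, 0)) by rewrite pa.
  have nw : (loc p w != (0, 0)) || (loc q w != (0, 0)) by rewrite pw.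
  have [c [c0 pc qc]] := rank1P (ns a) na; have [d [d0 pd qd]] := rank1P (ns w) nw.
  have [gu cu hu] := local_X a c0; have [gw cw hw] := local_Z w d0.
  have [f [cf fo fu fw]] := cz_step aS wS aw cu cw.
  have fpa : loc (f p) a = (1, 0).
    by rewrite fu (hu p _ pc) (hw p _ pd) /ind pa /= addr0.
  have fqa : loc (f q) a = (0, 0).
    by rewrite fu (hu q _ qc) (hw q _ qd) /ind qa eqxx /= addr0.
  have fpw : loc (f p) w = (0, 0).
    by rewrite fw (hu p _ pc) (hw p _ pd) /ind pa pw /= F2xx.
  have fqw : loc (f q) w = (0, 1).
    by rewrite fw (hu q _ qc) (hw q _ qd) /ind qw qa eqxx /= addr0.
  have ba : b != a by rewrite eq_sym.
  have fpb : loc (f p) b = (0, 0) by rewrite fo.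
  have fqb : loc (f q) b = loc q b by rewrite fo.
  have [f' [cf' fo' [fpw' fqw'] [fpb' fqb']]] : exists f', [/\ circuit S 1 f',
    forall p v, v != b -> v != w -> loc (f' p) v = loc p v,
    loc (f' (f p)) w = (0, 0) /\ loc (f' (f q)) w = (0, 0) &
    loc (f' (f p)) b = (ind (loc (f p) b), 0) /\ loc (f' (f q)) b = (ind (loc (f q) b), 0)].
    apply: merge_types => //; rewrite /sgn /typ ?fpb ?fpw ?fqb ?fqw /sym /= ?mul0r ?addr0 ?qb //.
  apply: (pair_cleared_step cf (k := k)).
  apply: (pair_cleared_le k1); apply: (pair_cleared_step cf' (k := 0)).
  rewrite fpb /ind eqxx fqb qb in fpb' fqb'.
  have fpa' : loc (f' (f p)) a = (1, 0) by rewrite fo'.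
  have fqa' : loc (f' (f q)) a = (0, 0) by rewrite fo'.
  have out v : v != a -> v != b -> v != w -> loc (f' (f p)) v = (0, 0) /\ loc (f' (f q)) v = (0, 0).
    move=> va vb vw; rewrite !fo' // !fo //.
    have : v \notin U by rewrite UE !inE !negb_or va vb vw.
    by rewrite tU negbK => /eqP[/negbFE/eqP-> /negbFE/eqP->].
  apply: (@pair_cleared0 _ a b) => //.
  + move=> v; rewrite /sgn; case: (eqVneq v w) => [->|vw].
      by rewrite fpw' fqw' /sym mulr0 addr0.
    case: (eqVneq v a) => [->|va]; first by rewrite fqa' /sym !mulr0 addr0.
    case: (eqVneq v b) => [->|vb]; first by rewrite fpb' /sym !mul0r addr0.
    by have [-> ->] := out v va vb vw; rewrite /sym mulr0 addr0.
  + apply/subsetP=> v; rewrite !inE nz_loc; case: (eqVneq v a) => //= va.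
    case: (eqVneq v b) => //= vb; case: (eqVneq v w) => [->|vw]; first by rewrite fpw'.
    by rewrite (out v va vb vw).1.
  + apply/subsetP=> v; rewrite !inE nz_loc; case: (eqVneq v a) => //= va.
    case: (eqVneq v b) => //= vb; case: (eqVneq v w) => [->|vw]; first by rewrite fqw'.
    by rewrite (out v va vb vw).2.
Qed.

Definition mu p q := (\sum_v mval (loc p v) (loc q v))%N.

Lemma mu_step p q p' q' a w : a != w ->
  (forall v, v != a -> v != w -> loc p' v = loc p v /\ loc q' v = loc q v) ->
  (mu p' q' + (mval (loc p a) (loc q a) + mval (loc p w) (loc q w)) =
   mu p q + (mval (loc p' a) (loc q' a) + mval (loc p' w) (loc q' w)))%N.
Proof.
move=> aw h; rewrite /mu (bigD1 a) // (bigD1 w) 1?eq_sym //=.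
rewrite [in RHS](bigD1 a) // [in RHS](bigD1 w) 1?eq_sym //=.
rewrite (eq_bigr (fun v => mval (loc p v) (loc q v))); last first.
  by move=> v /andP[va vw]; have [-> ->] := h v va vw.
set m := (\sum_(v | _) _)%N; move: m; lia.
Qed.

(* Every CZ gate lowers mu by 2, and the last pair of anticommuting coordinates
   has mu = 6 and needs one gate. *)
Lemma pair_cleared_star k S p q a :
  omega p q = 0 -> supp p :|: supp q \subset S -> sgn p q a = 1 ->
  (mu p q <= 2 * k + 4)%N -> pair_cleared S k p q.
Proof.
elim: k p q a => [|k IH] p q a o0 sub sa hmu.
  (* The local signs add up to [omega p q = 0], so the number of stars is even and a second one
     exists. For k = 0 two stars already contribute 6, above the allowed 4. *)
  all: have [w aw sw] : exists2 w, a != w & sgn p q w = 1.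
  1,3: case: (pickP (fun w => (a != w) && (sgn p q w == 1))) => [w /andP[aw /eqP sw]|h];
    first by exists w.
  1,2: have : \sum_(v | v != a) sgn p q v = 0 by
    apply: big1 => w; rewrite eq_sym => aw; have := h w; rewrite aw /=;
    case: (F2P (sgn p q w)) => ->.
  1,2: by move=> e; move: o0; rewrite omegaE (bigD1 a) //= sa e addr0.
  have : (mval (loc p a) (loc q a) + mval (loc p w) (loc q w) <= mu p q)%N.
    rewrite /mu (bigD1 a) // (bigD1 w) 1?eq_sym //=; lia.
  by rewrite !mval_star // => /leq_trans/(_ hmu).
have inS v : sgn p q v = 1 -> v \in S.
  move=> /star_neq0/andP[h _]; apply: (subsetP sub).
  by rewrite inE loc0_supp h.
have aS := inS a sa; have wS := inS w sw.
case: (pickP (fun v => (sgn p q v == 0) && ((loc p v != (0, 0)) || (loc q v != (0, 0))))) =>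
  [v /andP[/eqP sv nv]|all_star].
  (* A commuting coordinate [v] is cancelled against the star [a]: [mval] drops from 2 to 0 at [v]
     and stays 3 at [a]. *)
  have va : a != v by apply/negP=> /eqP e; move: sa; rewrite e sv.
  have vS : v \in S by apply: (subsetP sub); rewrite inE !loc0_supp.
  have [d [d0 pd qd]] := rank1P sv nv.
  have nind : (ind (loc p v) != 0) || (ind (loc q v) != 0).
    by move: nv; rewrite /ind; do 2!case: (loc _ v != _).
  have [al [be [y [z [sab pa qa syz]]]]] := star_basis sa nind.
  have [gu cu hu] := local_sym a sab; have [gw cw hw] := local_Z v d0.
  have [f [cf fo fu fw]] := cz_step aS vS va cu cw.
  have fpa : loc (f p) a = (ind (loc p v), y).
    by rewrite fu (hu p _ _ pa) (hw p _ pd) /= addr0.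
  have fqa : loc (f q) a = (ind (loc q v), z).
    by rewrite fu (hu q _ _ qa) (hw q _ qd) /= addr0.
  have fpv : loc (f p) v = (0, 0).
    by rewrite fw (hu p _ _ pa) (hw p _ pd) /= F2xx.
  have fqv : loc (f q) v = (0, 0).
    by rewrite fw (hu q _ _ qa) (hw q _ qd) /= F2xx.
  apply: (pair_cleared_step cf (k := k)).
  apply: (IH _ _ a).
  + by rewrite (circuit_omega _ _ cf).
  + apply/subsetP=> x; rewrite inE !loc0_supp; case: (eqVneq x a) => [->//|xa].
    case: (eqVneq x v) => [->//|xv]; rewrite !fo // -!loc0_supp => h.
    by apply: (subsetP sub); rewrite inE.
  + by rewrite /sgn fpa fqa.
  + have := @mu_step p q (f p) (f q) a v va.
    rewrite !fpv !fqv !fpa !fqa (mval_star sa) (mval_star syz) (mval_rank1 sv nv).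
    move=> /(_ (fun x xa xv => conj (fo p x xa xv) (fo q x xa xv))).
    have -> : mval (0, 0) (0, 0) = 0%N by [].
    by move: hmu; move: (mu p q) (mu (f p) (f q)) => m m'; clear; lia.
(* Only stars are left. With the roles of [p] and [q] exchanged at [w], one CZ gate leaves [p] as X
   at [a] only and [q] as X at [w] only on these two qubits, so 3 + 3 becomes 2 + 2. *)
have sC : sym (loc q w) (loc p w) = 1 by rewrite symC.
have [gu cu hu] := local_sym a sa; have [gw cw hw] := local_sym w sC.
have [f [cf fo fu fw]] := cz_step aS wS aw cu cw.
have gpa := hu p 1 0 (esym (lc10 _ _)); have gqa := hu q 0 1 (esym (lc01 _ _)).
have gpw := hw p 0 1 (esym (lc01 _ _)); have gqw := hw q 1 0 (esym (lc10 _ _)).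
have fpa : loc (f p) a = (1, 0) by rewrite fu gpa gpw /= addr0.
have fqa : loc (f q) a = (0, 0) by rewrite fu gqa gqw /= F2xx.
have fpw : loc (f p) w = (0, 0) by rewrite fw gpa gpw /= F2xx.
have fqw : loc (f q) w = (1, 0) by rewrite fw gqa gqw /= addr0.
have sub' : supp (f p) :|: supp (f q) \subset supp p :|: supp q.
  apply/subsetP=> x; rewrite !in_setU !loc0_supp.
  case: (eqVneq x a) => [->|xa]; first by rewrite (andP (star_neq0 sa)).1.
  case: (eqVneq x w) => [->|xw]; first by rewrite (andP (star_neq0 sw)).1.
  by rewrite !fo.
apply: (pair_cleared_step cf (k := k)).
case: (pickP (fun b => [&& b != a, b != w & sgn p q b == 1])) => [b /and3P[ba bw /eqP sb]|no].
  apply: (IH _ _ b).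
  + by rewrite (circuit_omega _ _ cf).
  + exact: subset_trans sub' sub.
  + by rewrite /sgn !fo.
  + have := @mu_step p q (f p) (f q) a w aw.
    rewrite !fpw !fqw !fpa !fqa (mval_star sa) (mval_star sw).
    move=> /(_ (fun x xa xv => conj (fo p x xa xv) (fo q x xa xv))).
    have -> : mval (1, 0) (0, 0) = 2%N by [].
    have -> : mval (0, 0) (1, 0) = 2%N by [].
    by move: hmu; move: (mu p q) (mu (f p) (f q)) => m m'; clear; lia.
have out v : v != a -> v != w -> loc (f p) v = (0, 0) /\ loc (f q) v = (0, 0).
  move=> va vw; rewrite !fo //; have := no v; rewrite va vw /=.
  have := all_star v; case: (F2P (sgn p q v)) => -> //=.
  by move/negbT; rewrite negb_or !negbK => /andP[/eqP-> /eqP->].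
apply: (pair_cleared_le (leq0n k)); apply: (@pair_cleared0 _ a w) => //.
+ move=> v; rewrite /sgn; case: (eqVneq v a) => [->|va].
    by rewrite fqa /sym !mulr0 addr0.
  case: (eqVneq v w) => [->|vw]; first by rewrite fpw /sym !mul0r addr0.
  by have [-> ->] := out v va vw; rewrite /sym mulr0 addr0.
+ apply/subsetP=> v; rewrite !inE nz_loc; case: (eqVneq v a) => //= va.
  by case: (eqVneq v w) => [->|vw]; rewrite ?fpw // (out v va vw).1.
+ apply/subsetP=> v; rewrite !inE nz_loc; case: (eqVneq v a) => //= va.
  by case: (eqVneq v w) => [->|vw]; rewrite ?eqxx ?orbT // (out v va vw).2.
Qed.

End Pair.

(** * Isotropic subspaces *)

Section Subspaces.
Variable n : nat.
Local Notation pauli := (pauli n).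
Implicit Types (p q : pauli) (A S X : {set 'I_n}) (U : {vspace pauli}).

Definition zop (a : 'I_n) : pauli := mkp (fun=> 0) (fun v => (v == a)%:R).

Lemma zop0 a v : zop a 0 v = 0. Proof. exact: mkp0. Qed.
Lemma zop1 a v : zop a 1 v = (v == a)%:R. Proof. exact: mkp1. Qed.

Lemma omega_zop p a : omega p (zop a) = p 0 a.
Proof.
rewrite /omega (bigD1 a) //= zop0 zop1 eqxx mulr1 mulr0 addr0 big1 ?addr0 //.
by move=> v va; rewrite zop0 zop1 (negbTE va) !mulr0 addr0.
Qed.

Lemma Zon1 p a : Zon [set a] p -> p = p 1 a *: zop a.
Proof.
move=> h; apply: pauliP => v; rewrite !mxE; have [-> hv] := h v; rewrite mulr0; split=> //.
by case: (eqVneq v a) hv => [->|va] hv; rewrite ?mulr1 // mulr0 hv // inE.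
Qed.

Lemma Zon2 p a b : a != b -> Zon [set a; b] p -> p = p 1 a *: zop a + p 1 b *: zop b.
Proof.
move=> ab h; apply: pauliP => v; rewrite !mxE; have [-> hv] := h v.
rewrite !mulr0 addr0; split=> //.
case: (eqVneq v a) hv => [->|va] hv; first by rewrite (negbTE ab) mulr1 mulr0 addr0.
case: (eqVneq v b) hv => [->|vb] hv; first by rewrite mulr1 mulr0 add0r.
by rewrite !mulr0 addr0 hv // !inE negb_or va.
Qed.

Definition solvable A k U := exists l f,
  [/\ circuit A l f, (l <= k)%N & forall p, p \in U -> forall v, f p 0 v = 0].

Lemma solvable_circuit A l k f U : circuit A l f ->
  solvable A k (f @: U)%VS -> solvable A (l + k) U.
Proof.
move=> cf [l' [g [cg lk hg]]]; exists (l + l')%N, (g \o f)%VF; split.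
- exact: circuit_comp.
- by rewrite leq_add2l.
- by move=> p pU v; rewrite comp_lfunE hg // memv_img.
Qed.

Lemma isotropic_circuit A l f U : circuit A l f -> isotropic U -> isotropic (f @: U)%VS.
Proof.
move=> cf iU _ _ /memv_imgP[p pU ->] /memv_imgP[q qU ->].
by rewrite (circuit_omega _ _ cf) iU.
Qed.

Section Erase.
Variables (a : 'I_n) (U : {vspace pauli}).
Hypotheses (iU : isotropic U) (zU : zop a \in U).

Lemma isotropic_x0 p : p \in U -> p 0 a = 0.
Proof. by move=> pU; rewrite -omega_zop iU. Qed.

(** Members of [U] commute with Z at [a], so they have no X part there: forgetting [a] loses only a
    factor that is already Z-type. *)
Lemma erase_diff p : p \in U -> p = erase [set a] p + p 1 a *: zop a.
Proof.
move=> pU; apply: pauliP => v; rewrite !mxE !eraseE inE.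
case: (eqVneq v a) => [->|va]; last by rewrite !mulr0 !addr0.
by rewrite (isotropic_x0 pU) mulr0 mulr1 addr0 add0r.
Qed.

Lemma isotropic_erase : isotropic (erase [set a] @: U)%VS.
Proof.
move=> _ _ /memv_imgP[p pU ->] /memv_imgP[q qU ->]; rewrite -[RHS](iU pU qU).
apply: eq_bigr => v _; rewrite !eraseE inE; case: eqP => // ->.
by rewrite !isotropic_x0 // !mul0r !mulr0 addr0.
Qed.

Lemma dim_erase V : (V <= U)%VS -> (\dim V <= \dim (erase [set a] @: V) + 1)%N.
Proof.
move=> VU; rewrite -(limg_ker_dim (erase [set a]) V) addnC leq_add2l.
have : (V :&: lker (erase [set a]) <= <[zop a]>)%VS.
  apply/subvP=> p; rewrite memv_cap memv_ker => /andP[pV /eqP e0].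
  by rewrite (erase_diff (subvP VU p pV)) e0 add0r memvZ ?memv_line.
by move=> /dimvS/leq_trans; apply; rewrite dim_vline; case: (_ != _).
Qed.

Lemma erase_supported A : (U <= supported A)%VS -> (erase [set a] @: U <= supported (A :\ a))%VS.
Proof.
move=> /subvP UA; apply/subvP => _ /memv_imgP[p pU ->]; apply/supportedP => v.
rewrite !inE negb_and !negbK !eraseE inE; case: eqP => //= _ vA.
by have /supportedP := UA p pU; apply.
Qed.

Lemma solvable_erase A k : a \in A -> (U <= supported A)%VS ->
  solvable (A :\ a) k (erase [set a] @: U)%VS -> solvable A k U.
Proof.
move=> aA UA [l [f [cf lk hf]]]; exists l, f; split=> //.
  by apply: circuit_sub cf; exact: subsetDl.
move=> p pU v; rewrite (erase_diff pU) linearD linearZ /= (circuit_fix (p := zop a) cf).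
  by rewrite mxE hf ?memv_img // mxE zop0 mulr0 addr0.
move=> w; rewrite !inE => /andP[wa _]; rewrite zop0 zop1 (negbTE wa) //.
Qed.

End Erase.

(** The interface of a reduction inside [S] that spends [k] gates and removes [t] qubits. The last
    two fields record how the stabilizers supported on another set [X] change; nothing is claimed
    when [X] cuts across [S], which is why laminarity is needed later. *)
Record reduced A A' k U U' (S : {set 'I_n}) (t : nat) : Prop := Reduced {
  red_supported : (U' <= supported A')%VS;
  red_isotropic : isotropic U';
  red_solvable : forall j, solvable A' j U' -> solvable A (k + j) U;
  red_super : forall X, S \subset X ->
    (\dim (U :&: supported X) <= \dim (U' :&: supported X) + t)%N;
  red_disjoint : forall X, [disjoint S & X] ->
    (\dim (U :&: supported X) <= \dim (U' :&: supported X))%N }.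

Lemma reduced_refl A U S : (U <= supported A)%VS -> isotropic U -> reduced A A 0 U U S 0.
Proof. by move=> UA iU; split=> // X _; rewrite addn0. Qed.

Lemma reduced_trans A1 A2 A3 k l U1 U2 U3 S s t :
  reduced A1 A2 k U1 U2 S s -> reduced A2 A3 l U2 U3 S t ->
  reduced A1 A3 (k + l) U1 U3 S (s + t).
Proof.
move=> [_ _ s1 p1 d1] [w2 i2 s2 p2 d2]; split=> //.
- by move=> j /s2/s1; rewrite addnA.
- move=> X SX; apply: leq_trans (p1 X SX) _; rewrite addnCA [X in (X <= _)%N]addnC leq_add2l.
  exact: p2.
- by move=> X SX; apply: leq_trans (d1 X SX) _; exact: d2.
Qed.

(** A circuit on [S] preserves support in any superset of [S], where only the line of [zop a] is
    lost, and fixes every operator supported off [S]. *)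
Lemma reduced_erase A k l f U S a : S \subset A -> a \in S ->
  (U <= supported A)%VS -> isotropic U -> circuit S l f -> (l <= k)%N ->
  zop a \in (f @: U)%VS ->
  reduced A (A :\ a) k U (erase [set a] @: (f @: U))%VS S 1.
Proof.
move=> SA aS UA iU cf lk zU.
have iV := isotropic_circuit cf iU.
have VA : (f @: U <= supported A)%VS.
  apply/subvP=> _ /memv_imgP[p pU ->]; apply: (circuit_supported cf SA).
  exact: (subvP UA).
split.
- exact: erase_supported.
- exact: isotropic_erase.
- move=> j sj; have : solvable A (l + j) U.
    apply: (solvable_circuit (circuit_sub SA cf)).
    by apply: (solvable_erase iV zU _ VA sj); exact: (subsetP SA).
  move=> [l' [g [cg lk' hg]]]; exists l', g; split=> //; apply: leq_trans lk' _.
  by rewrite leq_add2r.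
- move=> X SX; have <- : \dim (f @: (U :&: supported X)) = \dim (U :&: supported X).
    apply: limg_dim_eq; have /lker0P/eqP -> := circuit_inj cf; exact: capv0.
  apply: (leq_trans (dim_erase iV zU (limgS f (capvSl _ _)))).
  rewrite leq_add2r; apply: dimvS; rewrite subv_cap limgS ?limgS ?capvSl //=.
  apply/subvP=> _ /memv_imgP[_ /memv_imgP[p pU ->] ->].
  move: pU; rewrite memv_cap => /andP[_ pX].
  have /supportedP h := circuit_supported cf SX pX.
  by apply/supportedP=> v vX; rewrite !eraseE; case: ifP => // _; exact: h.
- move=> X SX; apply: dimvS; apply/subvP=> p; rewrite !memv_cap => /andP[pU pX].
  rewrite pX andbT; have /supportedP h := pX.
  have hS v : v \in S -> p 0 v = 0 /\ p 1 v = 0.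
    by move=> vS; apply: h; apply: contraTN vS => vX; have := disjointFl SX vX => ->.
  have fp : f p = p by apply: (circuit_fix cf).
  have ep : erase [set a] p = p.
    by apply: pauliP=> v; rewrite !eraseE inE; case: eqP => // ->; have [-> ->] := hS a aS.
  by rewrite -ep -[in X in erase _ X]fp !memv_img.
Qed.

Lemma dim_gt0_pick U : (0 < \dim U)%N -> exists2 p, p \in U & p != 0.
Proof.
by rewrite lt0n dimv_eq0 => U0; exists (vpick U); [exact: memv_pick | rewrite vpick0].
Qed.

Lemma dim_lt_pick U V : (\dim V < \dim U)%N -> exists2 p, p \in U & p \notin V.
Proof. by move=> VU; apply/subvPn; apply: contraL VU => /dimvS; rewrite -leqNgt. Qed.

Lemma supported_capI A S U : (U <= supported A)%VS ->
  (U :&: supported S = U :&: supported (S :&: A))%VS.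
Proof.
move=> /subvP UA; apply/vspaceP=> p; rewrite !memv_cap.
case: (boolP (p \in U)) => //= pU; have := UA p pU.
by rewrite !supported_suppP subsetI => ->; rewrite andbT.
Qed.

(* Among the operators supported on S, those supported on (x + r) / 2 + 1 chosen
   qubits still form a non-zero subspace, x being the number of qubits of S. *)
Lemma reduce_one A S U r : (U <= supported A)%VS -> isotropic U ->
  (r < #|S :&: A|)%N -> (#|S :&: A| <= \dim (U :&: supported S) + r)%N ->
  exists a U', a \in S :&: A /\ reduced A (A :\ a) ((#|S :&: A| + r)./2) U U' S 1.
Proof.
move=> UA iU rx hx; rewrite (supported_capI S UA) in hx; set S0 := S :&: A in rx hx *.
have [Y [YS cY]] : exists Y : {set 'I_n}, Y \subset S0 /\ #|Y| = ((#|S0| + r)./2).+1.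
  have : (((#|S0| + r)./2).+1 <= #|S0|)%N by move: rx; clear; lia.
  move=> h; exists [set x in take ((#|S0| + r)./2).+1 (enum S0)]; split.
    by apply/subsetP=> x; rewrite inE => /mem_take; rewrite mem_enum.
  by rewrite cardsE (card_uniqP _) ?take_uniq ?enum_uniq // size_takel // -cardE.
have := dim_cap_supported Y (capvSr U (supported S0)); rewrite cardsD (setIidPr YS) cY.
have /subset_leq_card := YS; rewrite cY => hc hd.
(* With x = [#|S0|] and y = [#|Y|] the count leaves dimension at least (x - r) - 2(x - y) = 2y - (x
   + r), which is positive for y = floor((x + r)/2) + 1. *)
have : (0 < \dim (U :&: supported S0 :&: supported Y))%N by move: rx hx hc hd; clear; lia.
move=> /dim_gt0_pick[p]; rewrite !memv_cap => /andP[/andP[pU pS] pY] p0.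
have [] := @shrink_single _ S0 p (#|S0| + r)./2 p0.
- by rewrite -supported_suppP.
- by rewrite -cY; apply: subset_leq_card; rewrite -supported_suppP.
move=> l [f [a [cf lk aS za]]]; exists a; exists (erase [set a] @: (f @: U))%VS; split=> //.
have SA : S0 \subset A by exact: subsetIr.
have zU : zop a \in (f @: U)%VS.
  have := Zon1 za; case: (F2P (f p 1 a)) => ->; rewrite ?scale0r ?scale1r => e.
    by case/eqP: p0; apply: (circuit_inj cf); rewrite e linear0.
  by rewrite -e memv_img.
have [w1 i1 s1 p1 d1] := reduced_erase SA aS UA iU cf lk zU.
split=> //; first by move=> X SX; apply: p1; apply: subset_trans SX; exact: subsetIl.
move=> X SX.
have SX0 : [disjoint S0 & X].
  by apply: disjointWl SX; exact: subsetIl.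
exact: d1.
Qed.

(** With r + i active qubits in [S] one removal costs r + floor(i/2) gates, and floor(i/2) summed
    over i from 1 to t is floor(t^2/4). A removal lowers the count of active qubits by one and the
    dimension by at most one, so the hypotheses persist. *)
Lemma reduce_block A S U r t : (U <= supported A)%VS -> isotropic U ->
  #|S :&: A| = (r + t)%N -> (t <= \dim (U :&: supported S))%N ->
  exists A' U', [/\ A' \subset A, A :\: A' \subset S, #|S :&: A'| = r,
    (#|A'| + t)%N = #|A| & reduced A A' (r * t + (t * t) %/ 4) U U' S t].
Proof.
elim: t A U => [|t IH] A U UA iU cS dS.
  exists A, U; split=> //; rewrite ?setDv ?sub0set ?addn0 //; first by rewrite cS addn0.
  by rewrite muln0; exact: reduced_refl.
have [||a [U1 [aS red1]]] := reduce_one (S := S) (r := r) UA iU.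
- by rewrite cS addnS ltnS leq_addr.
- by rewrite cS addnC leq_add2r.
have [aS' aA] : a \in S /\ a \in A by move: aS; rewrite inE => /andP[].
have cS1 : #|S :&: (A :\ a)| = (r + t)%N.
  by apply: succn_inj; rewrite -addnS -cS setIDA (cardsD1 a (S :&: A)) aS.
have [|A' [U' [AA DS cS' cA red2]]] := IH (A :\ a) U1 (red_supported red1) (red_isotropic red1) cS1.
  by have := red_super red1 (subxx S); move: dS; clear; lia.
exists A', U'; split=> //.
- by apply: subset_trans AA _; exact: subsetDl.
- apply/subsetP=> x; rewrite inE => /andP[xA' xA].
  case: (eqVneq x a) => [->//|xa]; apply: (subsetP DS); by rewrite !inE xa xA xA'.
- by rewrite addnS cA (cardsD1 a A) aA.
have := reduced_trans red1 red2; rewrite add1n.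
congr (reduced _ _ _ _ _ _ _).
rewrite cS; move: (r * t)%N (mulnS r t) => x ->.
by move: x; clear; nia.
Qed.

End Subspaces.

(** * The quadratic bound: removing two qubits at a time *)

Section Generic.
Variable n : nat.
Local Notation pauli := (pauli n).
Implicit Types (p q : pauli) (A S X : {set 'I_n}) (U : {vspace pauli}).

Lemma wtE p : #|supp p| = (\sum_v (loc p v != (0, 0)%R))%N.
Proof. by rewrite -sum1dep_card big_mkcond; apply: eq_bigr => v _; rewrite nz_loc; case: (_ != _). Qed.

Lemma pauli_oppr p : - p = p.
Proof. by apply/eqP; rewrite eq_sym -addr_eq0; apply/eqP/pauliP => v; rewrite !mxE !F2xx. Qed.

Lemma loc_add_neq0 p q v : (loc (p + q) v != (0, 0)) = (loc p v != loc q v).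
Proof.
rewrite /loc !mxE !xpair_eqE -[q 0 v]opprK -[q 1 v]opprK.
have oppF (x : 'F_2) : - x = x by case: (F2P x) => ->; apply: val_inj.
by rewrite !addr_eq0 !opprK !oppF.
Qed.

Lemma muE p q : mu p q = (#|supp p| + #|supp q| + #|supp (p + q)%R|)%N.
Proof.
rewrite !wtE -!big_split /=; apply: eq_bigr => v _.
by rewrite /mval loc_add_neq0.
Qed.

(** The values 3, 2, 0 of [mval] have the parity of the local sign, so [mu] reduces to [omega]
    modulo 2. *)
Lemma mu_even p q : omega p q = 0 -> ~~ odd (mu p q).
Proof.
have natF m : (m%:R : 'F_2) = (odd m)%:R.
  elim: m => // m IH; rewrite mulrS IH /=.
  by case: (odd m); apply: val_inj.
have : (mu p q)%:R = omega p q.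
  rewrite omegaE natr_sum; apply: eq_bigr => v _; rewrite /sgn.
  by case: (F2_pairP (loc p v)) => ->; case: (F2_pairP (loc q v)) => ->; apply: val_inj.
by rewrite natF => <-; case: (odd _) => // /eqP.
Qed.

(* Each coordinate kills some non-zero vector of a three-dimensional space. *)
Lemma three_dim_weights S p q r :
  supp p \subset S -> supp q \subset S -> supp r \subset S ->
  (#|supp p| + #|supp q| + #|supp r| + #|supp (p + q)%R| + #|supp (p + r)%R| +
   #|supp (q + r)%R| + #|supp (p + q + r)%R| <= 6 * #|S|)%N.
Proof.
move=> ps qs rs; rewrite !wtE -!big_split /= -sum1_card big_distrr /= [X in (_ <= X)%N]big_mkcond /=.
apply: leq_sum => v _.
have out x : supp x \subset S -> v \notin S -> loc x v = (0, 0).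
  by move=> xs vS; apply/eqP; rewrite -[_ == _]negbK -loc0_supp; apply: contra vS => /(subsetP xs).
rewrite !locD !mxE /=; case: ifP => vS.
  by rewrite /loc; case: (F2P (p 0 v)) => ->; case: (F2P (p 1 v)) => ->; case: (F2P (q 0 v)) => ->;
     case: (F2P (q 1 v)) => ->; case: (F2P (r 0 v)) => ->; case: (F2P (r 1 v)) => ->.
move/negbT in vS.
have [-> ->] := out _ ps vS; have [-> ->] := out _ qs vS; have [-> ->] := out _ rs vS.
by rewrite (out _ ps vS) (out _ qs vS) (out _ rs vS) !addr0 eqxx.
Qed.

Lemma three_independent U : (2 < \dim U)%N -> exists p q r,
  [/\ p \in U, q \in U & r \in U] /\
  [/\ p != 0, q != 0, r != 0 & p + q != 0] /\
  [/\ p + r != 0, q + r != 0 & p + q + r != 0].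
Proof.
move=> dU; have vl (x : pauli) : (\dim <[x]> <= 1)%N by rewrite dim_vline; case: (_ != _).
have [|p pU p0] := @dim_gt0_pick _ U; first by apply: leq_trans dU.
have [|q qU qp] := @dim_lt_pick _ U <[p]>%VS.
  by apply: leq_ltn_trans (vl p) _; apply: leq_trans dU.
have [|r rU rp] := @dim_lt_pick _ U (<[p]> + <[q]>)%VS.
  apply: leq_ltn_trans (dimv_add_leqif _ _).1 _; apply: leq_ltn_trans dU.
  exact: (leq_add (vl p) (vl q)).
have pV : p \in (<[p]> + <[q]>)%VS by apply: (subvP (addvSl _ _)); exact: memv_line.
have qV : q \in (<[p]> + <[q]>)%VS by apply: (subvP (addvSr _ _)); exact: memv_line.
exists p, q, r; split=> //.
have sum0 (x y : pauli) : (x + y == 0) = (x == y) by rewrite addr_eq0 pauli_oppr.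
split; split=> //.
- by apply: contraNneq qp => ->; exact: mem0v.
- by apply: contraNneq rp => ->; exact: mem0v.
- by rewrite sum0; apply: contraNneq qp => <-; exact: memv_line.
- by rewrite sum0; apply: contraNneq rp => <-.
- by rewrite sum0; apply: contraNneq rp => <-.
- by rewrite sum0; apply: contraNneq rp => <-; exact: memvD.
Qed.

(* By averaging over the 7 lines of a three-dimensional subspace. *)
Lemma light_line S U : (2 < \dim (U :&: supported S))%N -> exists p q,
  [/\ p \in U, q \in U, supp p \subset S & supp q \subset S] /\
  [/\ p != 0, q != 0, p + q != 0 & (7 * mu p q <= 18 * #|S|)%N].
Proof.
move=> /three_independent[p [q [r [[]]]]].
rewrite !memv_cap !supported_suppP => /andP[pU ps] /andP[qU qs] /andP[rU rs].
case=> -[p0 q0 r0 pq0] [pr0 qr0 pqr0].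
have w := three_dim_weights ps qs rs.
have sD x y : supp x \subset S -> supp y \subset S -> supp (x + y) \subset S.
  by rewrite -!supported_suppP; exact: memvD.
have xx (x : pauli) : x + x = 0 by apply: pauliP => v; rewrite !mxE !F2xx.
have e1 : p + (p + q) = q by rewrite addrA xx add0r.
have e2 : p + (q + r) = p + q + r by rewrite addrA.
have e3 : q + (p + r) = p + q + r by rewrite addrCA addrA.
have e4 : r + (p + q) = p + q + r by rewrite addrC.
have e5 : (p + q) + (p + r) = q + r by rewrite addrACA xx add0r.
have mk x y z : x + y = z -> x \in U -> y \in U -> supp x \subset S -> supp y \subset S ->
    x != 0 -> y != 0 -> z != 0 ->
    (7 * (#|supp x| + #|supp y| + #|supp z|) <= 18 * #|S|)%N ->
    exists p q, [/\ p \in U, q \in U, supp p \subset S & supp q \subset S] /\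
      [/\ p != 0, q != 0, p + q != 0 & (7 * mu p q <= 18 * #|S|)%N].
  by move=> e xU yU xs ys x0 y0 z0 h; exists x, y; rewrite e muE e.
(* [l1] to [l7] are the lines of the Fano plane. Each vector lies on three of them, so their values
   of [mu] add up to at most 3 * 6 times the size of [S], and some line is at most the average. *)
have l1 := mk _ _ _ (erefl (p + q)) pU qU ps qs p0 q0 pq0.
have l2 := mk _ _ _ (erefl (p + r)) pU rU ps rs p0 r0 pr0.
have l3 := mk _ _ _ (erefl (q + r)) qU rU qs rs q0 r0 qr0.
have l4 := mk _ _ _ e2 pU (memvD qU rU) ps (sD _ _ qs rs) p0 qr0 pqr0.
have l5 := mk _ _ _ e3 qU (memvD pU rU) qs (sD _ _ ps rs) q0 pr0 pqr0.
have l6 := mk _ _ _ e4 rU (memvD pU qU) rs (sD _ _ ps qs) r0 pq0 pqr0.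
have l7 := mk _ _ _ e5 (memvD pU qU) (memvD pU rU) (sD _ _ ps qs) (sD _ _ ps rs) pq0 pr0 qr0.
move: l1 l2 l3 l4 l5 l6 l7 w; set P := (exists p, _).
move: #|supp p| #|supp q| #|supp r| #|supp (p + q)| #|supp (p + r)|
  #|supp (q + r)| #|supp (p + q + r)| #|S| => a b c d e f g s.
move: P => P; clear; move=> l1 l2 l3 l4 l5 l6 l7 w.
have : [\/ 7 * (a + b + d) <= 18 * s, 7 * (a + c + e) <= 18 * s | 7 * (b + c + f) <= 18 * s]%N \/
  [\/ 7 * (a + f + g) <= 18 * s, 7 * (b + e + g) <= 18 * s, 7 * (c + d + g) <= 18 * s
    | 7 * (d + e + f) <= 18 * s]%N.
  move: w; clear => w.
  case: (leqP (7 * (a + b + d)) (18 * s)) => h1; first by left; constructor 1.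
  case: (leqP (7 * (a + c + e)) (18 * s)) => h2; first by left; constructor 2.
  case: (leqP (7 * (b + c + f)) (18 * s)) => h3; first by left; constructor 3.
  case: (leqP (7 * (a + f + g)) (18 * s)) => h4; first by right; constructor 1.
  case: (leqP (7 * (b + e + g)) (18 * s)) => h5; first by right; constructor 2.
  case: (leqP (7 * (c + d + g)) (18 * s)) => h6; first by right; constructor 3.
  by right; constructor 4; lia.
by case=> [[]|[]].
Qed.

(** The images of [p] and [q] are independent in the plane spanned by [zop a] and [zop b], hence
    span it. *)
Lemma zop_mem_pair U f l S p q a b : circuit S l f -> p \in U -> q \in U ->
  p != 0 -> q != 0 -> p + q != 0 -> a != b ->
  Zon [set a; b] (f p) -> Zon [set a; b] (f q) ->
  zop a \in (f @: U)%VS /\ zop b \in (f @: U)%VS.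
Proof.
move=> cf pU qU p0 q0 pq0 ab hp hq.
have fp := memv_img f pU; have fq := memv_img f qU; have fpq := memvD fp fq.
have nz x : x != 0 -> f x != 0.
  by apply: contraNneq => e; apply/eqP; apply: (circuit_inj cf); rewrite e linear0.
have := nz _ p0; have := nz _ q0; have := nz _ pq0.
have xx (x : pauli) : x + x = 0 by apply: pauliP => v; rewrite !mxE !F2xx.
rewrite linearD /=; move: fp fq fpq; rewrite (Zon2 ab hp) (Zon2 ab hq).
move: (zop a) (zop b) => x y.
have e1 : x + y + x = y by rewrite addrAC xx add0r.
have e2 : x + y + y = x by rewrite -addrA xx addr0.
have e3 : x + (x + y) = y by rewrite addrA xx add0r.
have e4 : y + (x + y) = x by rewrite addrCA xx addr0.
case: (F2P (f p 1 a)) => ->; case: (F2P (f p 1 b)) => ->;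
case: (F2P (f q 1 a)) => ->; case: (F2P (f q 1 b)) => ->;
rewrite ?scale0r ?scale1r ?addr0 ?add0r ?e1 ?e2 ?e3 ?e4 ?xx ?eqxx //.
Qed.

Lemma solvable0 A : solvable A 0 (0%VS : {vspace pauli}).
Proof.
exists 0%N, \1%VF; split=> //; first exact: circuit_id.
by move=> p; rewrite memv0 => /eqP -> v; rewrite linear0 mxE.
Qed.

Lemma dim_reduced A A' k U U' S : (U <= supported A)%VS -> S \subset A ->
  reduced A A' k U U' S 1 -> (\dim U <= \dim U' + 1)%N.
Proof.
move=> UA SA red; have := red_super red SA; rewrite supported_capE // => /leq_trans; apply.
by rewrite leq_add2r; apply: dimvS; exact: capvSl.
Qed.

(** The function (m^2 + 3m - 4)/6 is 0 at m = 1 and 1 at m = 2, where single stabilizers are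
    cleared, and it grows by (2m + 1)/3 from m - 2 to m, the allowance for two qubits. *)
Lemma solvable_generic A U : (U <= supported A)%VS -> isotropic U ->
  (#|A| <= \dim U)%N -> (0 < #|A|)%N ->
  exists k, solvable A k U /\ (6 * k + 4 <= #|A| ^ 2 + 3 * #|A|)%N.
Proof.
move: {2}#|A| (leqnn #|A|) => m; elim: m A U => [|m IH] A U Am UA iU dU A0.
  by move: (leq_trans A0 Am).
have [A2|A3] := leqP #|A| 2.
  have : (0 < \dim U)%N by apply: leq_trans A0 dU.
  rewrite -{1}(supported_capE UA) => /dim_gt0_pick[p]; rewrite memv_cap supported_suppP => /andP[pU pA] p0.
  have [|l [f [a [cf lk aA za]]]] := shrink_single (k := #|A|.-1) p0 pA.
    by rewrite prednK //; exact: subset_leq_card.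
  have zU : zop a \in (f @: U)%VS.
    have := Zon1 za; case: (F2P (f p 1 a)) => ->; rewrite ?scale0r ?scale1r => e.
      by case/eqP: p0; apply: (circuit_inj cf); rewrite e linear0.
    by rewrite -e memv_img.
  have red := reduced_erase (subxx A) aA UA iU cf lk zU.
  have cA := cardsD1 a A; rewrite aA in cA.
  have dU' := dim_reduced UA (subxx A) red.
  case: (posnP #|A :\ a|) => [A'0|A'0].
    exists #|A|.-1; rewrite -[X in solvable _ X _]addn0; split; last first.
      by rewrite cA A'0.
    apply: (red_solvable red).
    suff -> : (erase [set a] @: (f @: U) = 0)%VS by exact: solvable0.
    apply/eqP; rewrite -subv0; apply: subv_trans (red_supported red) _.
    apply/subvP=> x; rewrite supported_suppP; move/eqP: A'0; rewrite cards_eq0 => /eqP ->.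
    by rewrite subset0 supp_eq0 memv0.
  have A1 : #|A| = 2%N by apply/eqP; rewrite eqn_leq A2 cA add1n ltnS.
  have [||k [sk hk]] := IH (A :\ a) _ _ (red_supported red) (red_isotropic red) _ A'0.
  - by move: Am A1 cA; clear; lia.
  - by move: dU dU' A1 cA; clear; lia.
  exists (#|A|.-1 + k)%N; split; first exact: (red_solvable red).
  have e : #|A :\ a| = 1%N by move: cA A1; clear; lia.
  by move: hk; rewrite A1 e; clear; lia.
(* The count leaves dimension at least 2(floor(m/2) + 2) - m on [S], which is at least 3 for both
   parities of m. *)
have [S [SA cS]] : exists S : {set 'I_n}, S \subset A /\ #|S| = (#|A|./2 + 2)%N.
  have h : (#|A|./2 + 2 <= #|A|)%N by move: A3; clear; lia.
  exists [set x in take (#|A|./2 + 2) (enum A)]; split.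
    by apply/subsetP=> x; rewrite inE => /mem_take; rewrite mem_enum.
  by rewrite cardsE (card_uniqP _) ?take_uniq ?enum_uniq // size_takel // -cardE.
have [|p [q [[pU qU ps qs] [p0 q0 pq0 hmu]]]] := @light_line S U.
  have := dim_cap_supported S UA; rewrite cardsD (setIidPr SA) cS.
  by move: dU A3; clear; lia.
have o0 : omega p q = 0 by exact: iU.
have [k [ck hk]] : exists k, pair_cleared S k p q /\ (3 * k <= 2 * #|A| + 1)%N.
  have sub : supp p :|: supp q \subset S by rewrite subUset ps.
  case: (pickP (fun v => sgn p q v == 1)) => [v /eqP sv|ns].
    (* For even [mu p q] halving is exact, as [pair_cleared_star] requires; an odd value would fall
       short by one. If the subtraction truncates, its bound of 4 still holds. *)
    have ev := mu_even o0.
    exists ((mu p q)./2 - 2)%N; split.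
      by apply: (pair_cleared_star o0 sub sv); move: ev; clear; lia.
    by move: ev hmu A3; rewrite cS; clear; lia.
  exists (#|A|./2).+1; split; last by move: A3; clear; lia.
  apply: pair_cleared_nostar => //.
    by move=> v; have := ns v; case: (F2P (sgn p q v)) => ->.
  have -> /= : (#|supp p :|: supp q| <= (#|A|./2).+2)%N.
    by rewrite -[X in (_ <= X)%N]addn2 -cS; exact: subset_leq_card.
  (* Two distinct non-trivial Paulis on a single qubit anticommute, so without stars the joint
     support has at least two qubits. *)
  rewrite andbT ltnNge; apply: contraTN isT => U1.
  have [v sv] : exists v, supp p :|: supp q \subset [set v].
    case: (posnP #|supp p :|: supp q|) => [|gt0].
      move/eqP; rewrite cards_eq0 setU_eq0 supp_eq0 (negbTE p0) //.
    have /cards1P[v ->] : #|supp p :|: supp q| == 1%N by rewrite eqn_leq U1.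
    by exists v.
  have one x : supp x \subset [set v] -> loc x v = (0, 0) -> x = 0.
    move=> xs x0; apply/eqP; rewrite -supp_eq0 -subset0; apply/subsetP=> w wx.
    by have := subsetP xs _ wx; rewrite inE => /eqP e; move: wx; rewrite e loc0_supp x0.
  move: sv; rewrite subUset => /andP[pv qv].
  have pl : loc p v != (0, 0) by apply: contraNneq p0 => /(one _ pv) ->.
  have ql : loc q v != (0, 0) by apply: contraNneq q0 => /(one _ qv) ->.
  have pql : loc (p + q) v != (0, 0).
    apply: contraNneq pq0 => /(one _ _) -> //.
    by rewrite -supported_suppP; apply: memvD; rewrite supported_suppP.
  move: pql (ns v); rewrite loc_add_neq0 /sgn; move: pl ql.
  by case: (F2_pairP (loc p v)) => ->; case: (F2_pairP (loc q v)) => ->.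
have [l [f [a [b [cf lk [aS bS ab] fp fq]]]]] := ck.
have [za zb] := zop_mem_pair cf pU qU p0 q0 pq0 ab fp fq.
have red1 := reduced_erase SA aS UA iU cf lk za.
set U1 := (erase [set a] @: (f @: U))%VS in red1.
have ba : b != a by rewrite eq_sym.
have bA : b \in A :\ a by rewrite !inE ba (subsetP SA).
(* Z at [b] survives the removal of [a], so [b] follows through the identity circuit at no cost. *)
have zb1 : zop b \in (\1 @: U1)%VS.
  rewrite lim1g; have <- : erase [set a] (zop b) = zop b; last exact: memv_img.
  apply: pauliP => v; rewrite !eraseE inE zop0 zop1; case: eqP => // ->.
  by rewrite eq_sym (negbTE ba).
have sb : [set b] \subset A :\ a by rewrite sub1set.
have red2 := reduced_erase sb (set11 b) (red_supported red1) (red_isotropic red1)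
  (circuit_id [set b]) (leq0n 0) zb1.
have d1 := dim_reduced UA SA red1.
have d2 := dim_reduced (red_supported red1) sb red2.
have cA := cardsD1 a A; rewrite (subsetP SA _ aS) in cA.
have cA' := cardsD1 b (A :\ a); rewrite bA in cA'.
have [|||j [sj hj]] := IH _ _ _ (red_supported red2) (red_isotropic red2).
- by move: Am cA cA'; clear; lia.
- by move: dU d1 d2 cA cA'; clear; lia.
- by move: A3 cA cA'; clear; lia.
exists (k + j)%N; split.
  by apply: (red_solvable red1); rewrite -[j]add0n; exact: (red_solvable red2).
move: hj hk cA; rewrite cA' => hj hk cA; rewrite cA; move: hj hk; rewrite cA.
by move: #|_| => x; clear; nia.
Qed.

End Generic.

(** * The linear bound: removing blocks along a laminar family *)

Section Family.
Variables (n : nat) (K : realFieldType) (r : nat) (F : {set 'I_n} -> Prop).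
Variables (sigma c n0 : K).
Local Notation pauli := (pauli n).
Implicit Types (p q : pauli) (A S X : {set 'I_n}) (U : {vspace pauli}).

Hypothesis laminar : forall X Y : {set 'I_n}, F X -> F Y ->
  [\/ [disjoint X & Y], X \subset Y | Y \subset X].
Hypothesis balanced : forall A, (r.+1 < #|A|)%N ->
  exists2 S, F S & (r < #|S :&: A| <= 2 * r)%N.
Hypothesis n0_ge1 : 1 <= n0.
Hypothesis small_bound : forall m k, n0 <= m%:R -> m%:R <= n0 + r%:R ->
  (6 * k + 4 <= m ^ 2 + 3 * m)%N -> k%:R <= sigma * m%:R - c.
Hypothesis block_bound : forall t, (t <= r)%N ->
  (r * t + (t * t) %/ 4)%:R <= sigma * t%:R.

Lemma solvable_family A U : (U <= supported A)%VS -> isotropic U ->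
  (#|A| <= \dim U)%N ->
  (forall X, F X -> (#|X :&: A| <= \dim (U :&: supported X) + r)%N) ->
  n0 <= #|A|%:R ->
  exists2 k, solvable A k U & k%:R <= sigma * #|A|%:R - c.
Proof.
move: {2}#|A| (leqnn #|A|) => m; elim: m A U => [|m IH] A U Am UA iU dU FU nA.
  move: (le_trans n0_ge1 nA); move: Am; rewrite leqn0 => /eqP ->.
  by rewrite ler10.
have [small|big] := lerP #|A|%:R (n0 + r%:R).
  have A0 : (0 < #|A|)%N.
    by rewrite -(ltr_nat K); apply: lt_le_trans nA; apply: lt_le_trans n0_ge1.
  have [k [sk hk]] := solvable_generic UA iU dU A0.
  by exists k => //; apply: small_bound.
(* [balanced] asks for more than r + 1 qubits because the vertex at the root leaf belongs to no cut;
   [n0] being at least 1 supplies the extra one. *)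
have rA : (r.+1 < #|A|)%N.
  by rewrite -(ltr_nat K) -addn1 natrD addrC; apply: le_lt_trans big; rewrite lerD2r.
have [S FS /andP[rS S2r]] := balanced rA.
set t := (#|S :&: A| - r)%N.
have tS : #|S :&: A| = (r + t)%N by rewrite subnKC // ltnW.
have t0 : (0 < t)%N by rewrite subn_gt0.
have tr : (t <= r)%N by rewrite leq_subLR addnn -mul2n.
have [|A' [U' [AA DS cS cA red]]] := reduce_block UA iU tS.
  by have := FU S FS; rewrite tS addnC leq_add2r.
have dX X : S \subset X -> (\dim (U :&: supported X) <= \dim (U' :&: supported X) + t)%N :=
  @red_super _ _ _ _ _ _ _ _ red X.
have cA' : #|A'|%:R = #|A|%:R - t%:R :> K by rewrite -cA natrD addrK.
have [||||k sk hk] := IH A' U' _ (red_supported red) (red_isotropic red).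
- by move: Am cA t0; clear; lia.
- have := dX _ (subsetT S); rewrite !supported_capE.
  + by move: dU cA; clear; lia.
  + by apply: subv_trans (red_supported red) (supported_sub (subsetT _)).
  + by apply: subv_trans UA (supported_sub (subsetT _)).
(* Disjoint from [S]: no stabilizer on [X] is lost. Containing [S]: exactly [t] active qubits and at
   most [t] dimensions go. Inside [S]: only [r] active qubits of [S] are left, and the inequality is
   trivial. *)
- move=> X FX; case: (laminar FS FX) => SX.
  + apply: leq_trans (leq_trans (FU X FX) _); last first.
      by rewrite leq_add2r; exact: (red_disjoint red).
    by apply: subset_leq_card; apply: setIS.
  + have := dX X SX; have := FU X FX.
    suff : (#|X :&: A'| + t <= #|X :&: A|)%N by clear; lia.
    have e : X :&: A :\: (X :&: A') = A :\: A'.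
      apply/setP=> x; rewrite !inE; case: (boolP (x \in A)) => xA; rewrite ?andbF //.
      case: (boolP (x \in A')) => xA' /=; first by rewrite andbT; case: (x \in X).
      by rewrite andbF /= andbT; apply: (subsetP SX); apply: (subsetP DS); rewrite inE xA xA'.
    rewrite -(cardsID (X :&: A') (X :&: A)) e (cardsD A A') (setIidPr AA) -cA.
    by rewrite (setIidPr (setIS X AA)) addKn.
  + apply: leq_trans (leq_addl _ _); rewrite -cS; apply: subset_leq_card.
    by apply: setSI.
(* More than n0 + r qubits minus a block of at most r leaves more than n0. *)
- by move: big cA' tr; rewrite -(ler_nat K); lra.
exists (r * t + (t * t) %/ 4 + k)%N; first exact: (red_solvable red).
have := block_bound tr; rewrite natrD; move: hk; rewrite cA'; lra.
Qed.

End Family.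

Lemma dim_limg_le (K : fieldType) (aT rT : vectType K) (f : 'Hom(aT, rT)) (U : {vspace aT}) :
  (\dim (f @: U) <= \dim U)%N.
Proof. by rewrite -(limg_ker_dim f U) leq_addl. Qed.

(** * The stabilizer space of a graph state *)

Section GraphPaulis.
Variables (n : nat) (adjn : rel 'I_n).
Hypothesis adjn_sym : symmetric adjn.
Local Notation pauli := (pauli n).

Definition stab (v : 'I_n) : pauli :=
  mkp (fun w => (w == v)%:R) (fun w => (adjn v w)%:R).

Definition gpauli_fun (u : 'rV['F_2]_n) : pauli :=
  mkp (fun v => u 0 v) (fun w => \sum_v u 0 v * (adjn v w)%:R).

Lemma gpauli_fun_is_linear : linear gpauli_fun.
Proof.
move=> a u v; apply: pauliP => w; rewrite !mxE /= ?mxE; split=> //.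
rewrite big_distrr -big_split /=; apply: eq_bigr => x _.
by rewrite !mxE mulrDl mulrA.
Qed.
HB.instance Definition _ :=
  GRing.isLinear.Build _ _ _ _ gpauli_fun gpauli_fun_is_linear.

Definition gspace : {vspace pauli} := (linfun gpauli_fun @: fullv)%VS.

Lemma gspaceP p : reflect (exists u, p = gpauli_fun u) (p \in gspace).
Proof.
apply: (iffP memv_imgP) => [[u _ ->]|[u ->]]; exists u; rewrite ?lfunE //.
by rewrite memvf.
Qed.

Lemma stab_gspace v : stab v \in gspace.
Proof.
apply/gspaceP; exists (delta_mx 0 v); apply: pauliP => w.
rewrite mkp0 mkp1 mkp0 mkp1; split; first by rewrite mxE.
rewrite (bigD1 v) //= mxE !eqxx mul1r big1 ?addr0 // => x xv.
by rewrite mxE (negbTE xv) andbF mul0r.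
Qed.

Lemma isotropic_gspace : isotropic gspace.
Proof.
move=> _ _ /gspaceP[u ->] /gspaceP[v ->].
rewrite /omega big_split /=.
rewrite (eq_bigr (fun w => \sum_x u 0 w * v 0 x * (adjn x w)%:R)); last first.
  by move=> w _; rewrite mkp0 mkp1 big_distrr; apply: eq_bigr => x _ /=; rewrite mulrA.
rewrite [X in _ + X](eq_bigr (fun w => \sum_x u 0 x * v 0 w * (adjn x w)%:R)); last first.
  move=> w _; rewrite mkp0 mkp1 big_distrl; apply: eq_bigr => x _ /=.
  by rewrite mulrAC.
rewrite [X in _ + X]exchange_big -big_split big1 //= => w _.
rewrite -big_split big1 //= => x _; by rewrite adjn_sym F2xx.
Qed.

Lemma gpauli_inj : injective gpauli_fun.
Proof.
move=> u v e; apply/rowP=> w.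
by have := congr1 (fun p : pauli => p 0 w) e; rewrite !mxE.
Qed.

Lemma dim_gspace : \dim gspace = n.
Proof.
rewrite limg_dim_eq ?dimvf /dim /= ?mul1n //.
have /lker0P/eqP -> : injective (linfun gpauli_fun).
  by move=> u v; rewrite !lfunE => /gpauli_inj.
exact: capv0.
Qed.

(** A product of generators at vertices of [X], selected by a row vector c, has no X part outside
    [X], and its Z part there is c times the cut matrix. The kernel of that matrix thus embeds into
    the stabilizers supported on [X]. *)
Lemma dim_gspace_supported (X : {set 'I_n}) :
  (#|X| <= \dim (gspace :&: supported X) +
    \rank (\matrix_(i < #|X|, j < #|~: X|) (adjn (enum_val i) (enum_val j))%:R : 'M['F_2]_(_, _)))%N.
Proof.
set M := \matrix_(i, j) _.
pose E : 'M['F_2]_(#|X|, n) := \matrix_(i, v) (enum_val i == v)%:R.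
pose fM := linfun (mulmxr M : 'rV_#|X| -> _).
pose g := (linfun gpauli_fun \o linfun (mulmxr E : 'rV_#|X| -> _))%VF.
have gE c : g c = gpauli_fun (c *m E) by rewrite comp_lfunE !lfunE.
have Eval (c : 'rV['F_2]_#|X|) i : (c *m E) 0 (enum_val i) = c 0 i.
  rewrite mxE (bigD1 i) //= mxE eqxx mulr1 big1 ?addr0 // => j ji.
  by rewrite mxE (inj_eq enum_val_inj) (negbTE ji) mulr0.
have Eout (c : 'rV['F_2]_#|X|) v : v \notin X -> (c *m E) 0 v = 0.
  move=> vX; rewrite mxE big1 // => i _; rewrite mxE; case: eqP => [e|]; last by rewrite mulr0.
  by case/negP: vX; rewrite -e enum_valP.
have dK : \dim (g @: lker fM) = \dim (lker fM).
  apply: limg_dim_eq; have /lker0P/eqP -> : injective g.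
    move=> c d; rewrite !gE => /gpauli_inj e; apply/rowP=> i.
    by rewrite -!Eval e.
  exact: capv0.
(* Factoring the matrix through its row base makes the image that of a space of dimension
   [\rank M]. *)
have dR : (\dim (limg fM) <= \rank M)%N.
  have -> : fM = (linfun (mulmxr (row_base M) : 'rV_(\rank M) -> _) \o
                 linfun (mulmxr (col_base M) : 'rV_#|X| -> _))%VF.
    by apply/lfunP=> c; rewrite comp_lfunE !lfunE /= -mulmxA mulmx_base.
  rewrite limg_comp.
  apply: leq_trans (dim_limg_le _ _) _.
  by apply: leq_trans (dimvS (subvf _)) _; rewrite dimvf /dim /= mul1n.
have dX : \dim {: 'rV['F_2]_#|X|} = #|X| by rewrite dimvf /dim /= mul1n.
rewrite -[X in (X <= _)%N]dX -(limg_ker_dim fM fullv) capfv leq_add // -dK.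
apply: dimvS; apply/subvP=> _ /memv_imgP[c ker_c ->]; rewrite gE memv_cap.
apply/andP; split; first by apply/gspaceP; exists (c *m E).
apply/supportedP=> w wX; rewrite mkp0 mkp1 Eout //; split=> //.
have wC : w \in ~: X by rewrite inE.
move: ker_c; rewrite memv_ker lfunE /= => /eqP/rowP/(_ (enum_rank_in wC w)).
rewrite mxE => e; rewrite mxE in e; rewrite -[RHS]e.
rewrite (bigID (mem X)) /= [X in _ + X]big1 ?addr0; last first.
  by move=> v vX; rewrite Eout // mul0r.
rewrite (big_enum_val (fun v => (c *m E) 0 v * (adjn v w)%:R)).
by apply: eq_bigr => i _; rewrite Eval mxE enum_rankK_in.
Qed.

End GraphPaulis.

(** * Operators on qubits *)

From mathcomp Require Import complex.
From mathcomp Require Import boolp classical_sets reals constructive_ereal ereal.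

Section Operators.
Local Open Scope sesquilinear_scope.
Variable C : numClosedFieldType.

Definition entry n (A : qop C n) (x y : bits n) : C := A (enum_rank x) (enum_rank y).

Lemma entry_ext n (A B : qop C n) : (forall x y, entry A x y = entry B x y) -> A = B.
Proof.
by move=> h; apply/matrixP=> i j; have := h (enum_val i) (enum_val j); rewrite /entry !enum_valK.
Qed.

Lemma sum_bits n (G : 'I_#|bits n| -> C) : \sum_i G i = \sum_(x : bits n) G (enum_rank x).
Proof. by rewrite (reindex enum_rank) //; apply: onW_bij; exact: enum_rank_bij. Qed.

Lemma entry_mul n (A B : qop C n) x z : entry (A *m B) x z = \sum_y entry A x y * entry B y z.
Proof. by rewrite /entry mxE sum_bits. Qed.

Lemma entry_scale n c (A : qop C n) x y : entry (c *: A) x y = c * entry A x y.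
Proof. by rewrite /entry mxE. Qed.

Lemma entry1 n (x y : bits n) : entry (1%:M : qop C n) x y = (x == y)%:R.
Proof. by rewrite /entry mxE (inj_eq enum_rank_inj). Qed.

Lemma entry_adj n (A : qop C n) x y : entry (A ^t*) x y = (entry A y x)^*.
Proof. by rewrite /entry !mxE. Qed.

Lemma entry_tensor n (h : 'I_n -> 'M[C]_2) x y :
  entry (tensor h) x y = \prod_j h j (x j) (y j).
Proof. by rewrite /entry mxE !enum_rankK. Qed.

Lemma tensor_mul n (h g : 'I_n -> 'M[C]_2) :
  tensor h *m tensor g = tensor (fun j => h j *m g j).
Proof.
apply: entry_ext => x z; rewrite entry_mul entry_tensor.
under [RHS]eq_bigr => j _ do rewrite mxE.
rewrite bigA_distr_bigA /=; apply: eq_bigr => y _.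
by rewrite !entry_tensor -big_split.
Qed.

Lemma tensor1 n : tensor (fun _ : 'I_n => 1%:M : 'M[C]_2) = 1%:M.
Proof.
apply: entry_ext => x y; rewrite entry_tensor entry1.
case: eqP => [->|xy]; first by rewrite big1 // => j _; rewrite mxE eqxx.
have [j xj] : exists j, x j != y j.
  apply/existsP; rewrite -negb_forall; apply/negP=> /forallP h; apply: xy.
  by apply/ffunP=> j; exact/eqP.
by rewrite (bigD1 j) //= mxE (negbTE xj) mul0r.
Qed.

Lemma tensor_scale n (c : 'I_n -> C) (h : 'I_n -> 'M[C]_2) :
  tensor (fun j => c j *: h j) = (\prod_j c j) *: tensor h.
Proof.
apply: entry_ext => x y; rewrite entry_scale !entry_tensor -big_split.
by apply: eq_bigr => j _; rewrite mxE.
Qed.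

Lemma eq_tensor n (h g : 'I_n -> 'M[C]_2) : h =1 g -> tensor h = tensor g.
Proof.
by move=> e; apply: entry_ext => x y; rewrite !entry_tensor; apply: eq_bigr => j _; rewrite e.
Qed.

Lemma tensor_adj n (h : 'I_n -> 'M[C]_2) : (tensor h) ^t* = tensor (fun j => (h j) ^t*).
Proof.
apply: entry_ext => x y; rewrite entry_adj !entry_tensor rmorph_prod.
by apply: eq_bigr => j _; rewrite !mxE.
Qed.

Section ActOn.
Variables (k m : nat) (f : 'I_k -> 'I_m).
Hypothesis f_inj : injective f.

Definition restr (x : bits m) : bits k := [ffun t => x (f t)].

Definition agree (x y : bits m) := [forall j, (j \notin codom f) ==> (x j == y j)].

(** For injective [f], [merge x] enumerates by k bits the labels that agree with [x] off the image
    of [f]; it turns sums over intermediate labels into sums over the qubits acted on. *)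
Definition merge (x : bits m) (t : bits k) : bits m :=
  [ffun j => if [pick i | f i == j] is Some i then t i else x j].

Lemma merge_in x t i : merge x t (f i) = t i.
Proof.
rewrite ffunE; case: pickP => [j /eqP/f_inj -> //|/(_ i)]; by rewrite eqxx.
Qed.

Lemma merge_out x t j : j \notin codom f -> merge x t j = x j.
Proof.
move=> jf; rewrite ffunE; case: pickP => // i /eqP e.
by case/negP: jf; rewrite -e codom_f.
Qed.

Lemma entry_act_on (U : qop C k) (x y : bits m) :
  entry (act_on f U) x y = if agree x y then entry U (restr x) (restr y) else 0.
Proof. by rewrite /entry mxE !enum_rankK. Qed.

Lemma agreeP (x y : bits m) : reflect (forall j, j \notin codom f -> x j = y j) (agree x y).
Proof.
apply: (iffP forallP) => h j; last by apply/implyP=> /h ->.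
by move=> jf; have := h j; rewrite jf => /eqP.
Qed.

Lemma agree_merge x t : agree x (merge x t).
Proof. by apply/agreeP=> j jf; rewrite merge_out. Qed.

Lemma restr_merge x t : restr (merge x t) = t.
Proof. by apply/ffunP=> i; rewrite ffunE merge_in. Qed.

Lemma merge_restr x y : agree x y -> merge x (restr y) = y.
Proof.
move=> /agreeP h; apply/ffunP=> j; case: (boolP (j \in codom f)) => [/codomP[i ->]|jf].
  by rewrite merge_in ffunE.
by rewrite merge_out // h.
Qed.

Lemma sum_agree (x : bits m) (G : bits m -> C) :
  \sum_(y | agree x y) G y = \sum_t G (merge x t).
Proof.
rewrite (reindex_onto (merge x) restr); last exact: merge_restr.
by apply: eq_bigl => t; rewrite agree_merge restr_merge eqxx.
Qed.

Lemma agree_sym x y : agree x y = agree y x.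
Proof. by apply/agreeP/agreeP => h j jf; rewrite h. Qed.

Lemma act_on_mul (U V : qop C k) : act_on f (U *m V) = act_on f U *m act_on f V.
Proof.
apply: entry_ext => x z; rewrite entry_mul entry_act_on.
rewrite (bigID (agree x)) /= [X in _ + X]big1 ?addr0; last first.
  by move=> y /negbTE xy; rewrite !entry_act_on xy mul0r.
rewrite sum_agree; case: ifP => xz.
  rewrite entry_mul; apply: eq_bigr => t _; rewrite !entry_act_on agree_merge restr_merge.
  suff -> : agree (merge x t) z by [].
  by apply/agreeP=> j jf; rewrite merge_out //; exact: (agreeP _ _ xz).
rewrite big1 // => t _; rewrite !entry_act_on agree_merge restr_merge.
suff -> : agree (merge x t) z = false by rewrite mulr0.
apply/negP=> /agreeP h; move/negP: xz; apply; apply/agreeP=> j jf.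
by rewrite -h // merge_out.
Qed.

Lemma act_on1 : act_on f (1%:M : qop C k) = 1%:M.
Proof.
apply: entry_ext => x y; rewrite entry_act_on !entry1.
case: ifP => [xy|/negP xy]; last by case: eqP => // e; case: xy; rewrite e; apply/agreeP.
congr (nat_of_bool _)%:R; apply/eqP/eqP=> [e|-> //].
rewrite -[RHS](merge_restr xy) -e merge_restr //; exact/agreeP.
Qed.

Lemma act_on_adj (U : qop C k) : (act_on f U) ^t* = act_on f (U ^t*).
Proof.
apply: entry_ext => x y; rewrite entry_adj !entry_act_on agree_sym.
by case: ifP => _; rewrite ?entry_adj // conjC0.
Qed.

Lemma prod_codom (g : 'I_m -> C) : \prod_(j in codom f) g j = \prod_i g (f i).
Proof.
rewrite (eq_bigl (mem [set f i | i : 'I_k])); last first.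
  move=> j; apply/codomP/imsetP=> [[i ->]|[i _ ->]]; first by exists i.
  by exists i.
by rewrite big_imset /=; [apply: eq_bigl | move=> i j _ _; exact: f_inj].
Qed.

(** Off the image of [f] the two tensors have equal factors, whose product [P] comes out of both
    sums; what remains is the hypothesis on k qubits. *)
Lemma act_on_tensor (U : qop C k) c (h h' : 'I_m -> 'M[C]_2) :
  (forall j, j \notin codom f -> h j = h' j) ->
  U *m tensor (fun i => h (f i)) = c *: (tensor (fun i => h' (f i)) *m U) ->
  act_on f U *m tensor h = c *: (tensor h' *m act_on f U).
Proof.
move=> hh' e; apply: entry_ext => x z; rewrite entry_scale !entry_mul.
rewrite (bigID (agree x)) /= [X in _ + X]big1 ?addr0; last first.
  by move=> y /negbTE xy; rewrite entry_act_on xy mul0r.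
rewrite sum_agree.
rewrite [in RHS](bigID (agree z)) /= [X in _ * (_ + X)]big1 ?addr0; last first.
  by move=> y /negbTE xy; rewrite entry_act_on agree_sym xy mulr0.
rewrite sum_agree.
have eL (y : bits m) : entry (tensor h) y z =
    entry (tensor (fun i => h (f i))) (restr y) (restr z) *
    \prod_(j | j \notin codom f) h j (y j) (z j).
  rewrite !entry_tensor (bigID (mem (codom f))) /= prod_codom; congr (_ * _).
  by apply: eq_bigr => i _; rewrite !ffunE.
have eR (y : bits m) : entry (tensor h') x y =
    entry (tensor (fun i => h' (f i))) (restr x) (restr y) *
    \prod_(j | j \notin codom f) h' j (x j) (y j).
  rewrite !entry_tensor (bigID (mem (codom f))) /= prod_codom; congr (_ * _).
  by apply: eq_bigr => i _; rewrite !ffunE.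
set P := \prod_(j | j \notin codom f) h j (x j) (z j).
rewrite (eq_bigr (fun t => entry U (restr x) t *
    entry (tensor (fun i => h (f i))) t (restr z) * P)); last first.
  move=> t _; rewrite entry_act_on agree_merge eL restr_merge mulrA; congr (_ * _).
  by apply: eq_bigr => j jf; rewrite merge_out.
rewrite [in RHS](eq_bigr (fun t => entry (tensor (fun i => h' (f i))) (restr x) t *
    entry U t (restr z) * P)); last first.
  move=> t _; rewrite entry_act_on agree_sym agree_merge eR restr_merge mulrAC; congr (_ * _).
  by apply: eq_bigr => j jf; rewrite merge_out // hh'.
rewrite -!big_distrl -!entry_mul /= e entry_scale /=; ring.
Qed.

End ActOn.

Lemma act_on_unitary k m (f : 'I_k -> 'I_m) (U : qop C k) :
  injective f -> U \is unitarymx -> act_on f U \is unitarymx.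
Proof.
move=> fi /unitarymxP e; apply/unitarymxP.
by rewrite act_on_adj -act_on_mul // e act_on1.
Qed.

End Operators.

(** * The gates H, S, Z and CZ as Clifford operators *)

Section Gates.
Local Open Scope sesquilinear_scope.
Variable C : numClosedFieldType.

(* The one-qubit Pauli X^x Z^z. *)
Definition sigma (x z : 'F_2) : 'M[C]_2 :=
  \matrix_(a, b) (((a != b) == (x == 1))%:R * (-1) ^+ (z * b)%N).

Definition hmx : 'M[C]_2 := (sqrtC 2)^-1 *: \matrix_(a, b) (-1) ^+ (a * b)%N.
Definition smx : 'M[C]_2 := \matrix_(a, b) ((a == b)%:R * 'i ^+ a).

Lemma mulmx2 (A B : 'M[C]_2) a b : (A *m B) a b = A a 0 * B 0 b + A a 1 * B 1 b.
Proof.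
rewrite mxE big_ord_recl big_ord1; congr (_ + A a _ * B _ b); exact: val_inj.
Qed.

Lemma sigma00 : sigma 0 0 = 1%:M.
Proof.
apply/matrixP=> a b; rewrite !mxE.
by case: (I2P a) => ->; case: (I2P b) => ->; rewrite ?mulr1.
Qed.

Lemma sigma10 : sigma 1 0 = pauliX C.
Proof.
apply/matrixP=> a b; rewrite !mxE.
by case: (I2P a) => ->; case: (I2P b) => ->; rewrite ?mulr1.
Qed.

Lemma sigma01 : sigma 0 1 = pauliZ C.
Proof.
apply/matrixP=> a b; rewrite !mxE.
by case: (I2P a) => ->; case: (I2P b) => ->; rewrite ?mul1r ?mul0r.
Qed.

Lemma pauliYE : pauliY C = 'i *: sigma 1 1.
Proof.
congr (_ *: _); apply/matrixP=> a b; rewrite mulmx2 !mxE.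
by case: (I2P a) => ->; case: (I2P b) => ->; rewrite /= ?mul0r ?mulr0 ?mul1r ?add0r ?addr0.
Qed.

Lemma hmx_sigma x z : hmx *m sigma x z = (-1) ^+ (x * z)%N *: (sigma z x *m hmx).
Proof.
rewrite /hmx -scalemxAl -scalemxAr [RHS]scalerA mulrC -scalerA; congr (_ *: _).
apply/matrixP=> a b; rewrite mulmx2 [RHS]mxE mulmx2 !mxE.
by case: (I2P a) => ->; case: (I2P b) => ->; case: (F2P x) => ->; case: (F2P z) => ->;
   rewrite /= ?expr0 ?expr1; ring.
Qed.

Lemma smx_sigma x z : smx *m sigma x z = 'i ^+ x *: (sigma x (z + x) *m smx).
Proof.
have ii : 'i * 'i = -1 :> C by rewrite -expr2 sqrCi.
apply/matrixP=> a b; rewrite mulmx2 [RHS]mxE mulmx2 !mxE.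
case: (I2P a) => ->; case: (I2P b) => ->; case: (F2P x) => ->; case: (F2P z) => ->;
  rewrite /= ?expr0 ?expr1 ?add0r ?addr0 ?mul0r ?mulr0 ?add0r ?addr0 ?mul1r ?mulr1 //;
  rewrite ?mulrN1 ?mulN1r ?mulrN ?mulNr ?ii ?opprK ?mulr0 //.
Qed.

Lemma hmxK : hmx *m hmx = 1%:M.
Proof.
have c2 : (sqrtC 2)^-1 * (sqrtC 2)^-1 = 2^-1 :> C by rewrite -invfM -expr2 sqrtCK.
rewrite /hmx -scalemxAl -scalemxAr scalerA c2.
apply/matrixP=> a b; rewrite mxE mulmx2 !mxE.
by case: (I2P a) => ->; case: (I2P b) => ->; rewrite /= ?expr0 ?expr1; field.
Qed.

Lemma hmx_adj : hmx ^t* = hmx.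
Proof.
apply/matrixP=> a b; rewrite !mxE rmorphM /= rmorphXn rmorphN1 mulnC; congr (_ * _).
by rewrite geC0_conj // invr_ge0 sqrtC_ge0 ler0n.
Qed.

Lemma smx_adj : smx ^t* *m smx = 1%:M.
Proof.
have ii : 'i * 'i = -1 :> C by rewrite -expr2 sqrCi.
apply/matrixP=> a b; rewrite mulmx2 !mxE.
case: (I2P a) => ->; case: (I2P b) => ->;
  by rewrite /= ?expr0 ?expr1 ?mul0r ?mul1r ?conjC0 ?conjC1 ?conjCi ?mul0r ?mulr0 ?mulr1 ?mul1r
     ?add0r ?addr0 ?mulNr ?ii ?opprK.
Qed.

Lemma pauliZK : pauliZ C *m pauliZ C = 1%:M.
Proof.
apply/matrixP=> a b; rewrite mulmx2 !mxE.
by case: (I2P a) => ->; case: (I2P b) => ->;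
  rewrite /= ?expr0 ?expr1 ?mul0r ?mul1r ?mulr0 ?add0r ?addr0 ?mulrNN ?mulr1.
Qed.

Lemma smx4 : smx *m smx *m (smx *m smx) = 1%:M.
Proof.
suff -> : smx *m smx = pauliZ C by exact: pauliZK.
have ii : 'i * 'i = -1 :> C by rewrite -expr2 sqrCi.
apply/matrixP=> a b; rewrite mulmx2 !mxE.
case: (I2P a) => ->; case: (I2P b) => ->;
  by rewrite /= ?expr0 ?expr1 ?mul0r ?mul1r ?mulr0 ?mulr1 ?add0r ?addr0 ?ii.
Qed.

Definition pg n (p : pauli n) : qop C n := tensor (fun j => sigma (p 0 j) (p 1 j)).

Lemma i4 : 'i ^+ 4 = 1 :> C.
Proof. by rewrite (exprM _ 2 2) sqrCi sqrrN expr1n. Qed.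

(** Replaces membership in the list of phases by an equation that is stable under products. *)
Lemma unit4P (c : C) : (c \in [:: 1; -1; 'i; - 'i]) = (c ^+ 4 == 1).
Proof.
have -> : (c ^+ 4 == 1) = ((c - 1) * (c + 1) * ((c - 'i) * (c + 'i)) == 0).
  rewrite -subr_eq0; congr (_ == 0); rewrite -!subr_sqr sqrCi; ring.
by rewrite !inE !mulf_eq0 !subr_eq0 !addr_eq0 -!orbA.
Qed.

Lemma pauli_mxP (h : 'M[C]_2) : h \in [:: 1%:M; pauliX C; pauliY C; pauliZ C] ->
  exists u : C * ('F_2 * 'F_2), u.1 ^+ 4 = 1 /\ h = u.1 *: sigma u.2.1 u.2.2.
Proof.
rewrite !inE => /or4P[]/eqP->.
- by exists (1, (0, 0)); rewrite expr1n scale1r sigma00.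
- by exists (1, (1, 0)); rewrite expr1n scale1r sigma10.
- by exists ('i, (1, 1)); rewrite i4 pauliYE.
- by exists (1, (0, 1)); rewrite expr1n scale1r sigma01.
Qed.

Lemma sigma_pauli x z : exists u : C * 'M[C]_2, [/\ u.1 ^+ 4 = 1,
  u.2 \in [:: 1%:M; pauliX C; pauliY C; pauliZ C] & sigma x z = u.1 *: u.2].
Proof.
case: (F2P x) => ->; case: (F2P z) => ->.
- by exists (1, 1%:M); rewrite expr1n scale1r sigma00 !inE eqxx.
- by exists (1, pauliZ C); rewrite expr1n scale1r sigma01 !inE eqxx !orbT.
- by exists (1, pauliX C); rewrite expr1n scale1r sigma10 !inE eqxx !orbT.
- exists (- 'i, pauliY C); rewrite !inE eqxx !orbT pauliYE scalerA; split=> //.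
    by rewrite (exprM _ 2 2) sqrrN sqrCi sqrrN expr1n.
  by rewrite mulNr -expr2 sqrCi opprK scale1r.
Qed.

Lemma pauli_groupP n (A : qop C n) :
  pauli_group A <-> exists c p, c ^+ 4 = 1 /\ A = c *: pg p.
Proof.
have prod4 (c : 'I_n -> C) : (forall j, c j ^+ 4 = 1) -> (\prod_j c j) ^+ 4 = 1.
  by move=> h; rewrite -prodrXl big1.
split=> [[c [h [c4 hh ->]]]|[c [p [c4 ->]]]].
  have [u hu] := fin_all_exists (fun j => pauli_mxP (hh j)).
  exists (c * \prod_j (u j).1), (mkp (fun j => (u j).2.1) (fun j => (u j).2.2)); split.
    rewrite exprMn prod4 ?mulr1; last by move=> j; case: (hu j).
    by apply/eqP; rewrite -unit4P.
  rewrite -scalerA -tensor_scale; congr (_ *: _); apply: eq_tensor => j.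
  by rewrite mkp0 mkp1; case: (hu j).
have [u hu] := fin_all_exists (fun j => sigma_pauli (p 0 j) (p 1 j)).
exists (c * \prod_j (u j).1), (fun j => (u j).2); split.
- rewrite unit4P exprMn c4 prod4 ?mulr1 //.
  by move=> j; case: (hu j).
- by move=> j; case: (hu j).
- rewrite -scalerA -tensor_scale; congr (_ *: _); apply: eq_tensor => j.
  by case: (hu j).
Qed.

(* As U ^ 4 = 1, conjugating by U three times inverts conjugation by U. *)
Lemma cliffordP n (U : qop C n) : U \is unitarymx ->
  (forall p, exists c p', c ^+ 4 = 1 /\ U *m pg p = c *: (pg p' *m U)) ->
  U *m U *m (U *m U) = 1%:M ->
  clifford_group U.
Proof.
move=> uU hU U4; split=> //.
have fwd A : pauli_group A -> pauli_group (U *m A *m U ^t*).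
  move=> /pauli_groupP[c [p [c4 ->]]]; apply/pauli_groupP.
  have [d [p' [d4 e]]] := hU p; exists (c * d), p'; split.
    by rewrite exprMn c4 d4 mulr1.
  rewrite -scalemxAr -scalemxAl e -scalemxAl scalerA; congr (_ *: _).
  by rewrite -mulmxA (unitarymxP uU) mulmx1.
rewrite eqEsubset; split=> [_ [A hA <-]|A hA]; first exact: fwd.
exists (U *m (U *m (U *m A *m U ^t*) *m U ^t*) *m U ^t*); first exact: fwd _ (fwd _ (fwd _ hA)).
have U4' : U ^t* *m U ^t* *m (U ^t* *m U ^t*) = 1%:M.
  by rewrite -!map_mxM -!trmx_mul U4 trmx1 map_mx1.
transitivity ((U *m U *m (U *m U)) *m A *m (U ^t* *m U ^t* *m (U ^t* *m U ^t*))).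
  by rewrite !mulmxA.
by rewrite U4 U4' mul1mx mulmx1.
Qed.

Definition qop1 (u : 'M[C]_2) : qop C 1 := tensor (fun=> u).

Lemma pg1 (p : pauli 1) : pg p = qop1 (sigma (p 0 0) (p 1 0)).
Proof. by apply: eq_tensor => j; rewrite (ord1 j). Qed.

Lemma qop1_mul u v : qop1 u *m qop1 v = qop1 (u *m v).
Proof. exact: tensor_mul. Qed.

Lemma qop1_scale c u : qop1 (c *: u) = c *: qop1 u.
Proof. by rewrite /qop1 (tensor_scale (fun=> c)) big_ord1. Qed.

Lemma qop1_clifford u : u ^t* *m u = 1%:M -> u *m u *m (u *m u) = 1%:M ->
  (forall x z, exists c x' z', c ^+ 4 = 1 /\ u *m sigma x z = c *: (sigma x' z' *m u)) ->
  clifford_group (qop1 u).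
Proof.
move=> uu u4 hu; apply: cliffordP.
- apply/unitarymxP; rewrite tensor_adj [_ *m _]qop1_mul; have := mulmx1C uu => ->.
  exact: tensor1.
- move=> p; have [c [x [z [c4 e]]]] := hu (p 0 0) (p 1 0).
  exists c, (mkp (fun=> x) (fun=> z)); split=> //.
  by rewrite !pg1 mkp0 mkp1 !qop1_mul e qop1_scale.
- by rewrite !qop1_mul u4; exact: tensor1.
Qed.

Lemma hmx_clifford : clifford_group (qop1 hmx).
Proof.
apply: qop1_clifford => [||x z]; rewrite ?hmx_adj ?hmxK ?mulmx1 //.
exists ((-1) ^+ (x * z)%N), z, x; rewrite hmx_sigma; split=> //.
by rewrite -exprM mulnC exprM (exprM _ 2 2) sqrrN !expr1n.
Qed.

Lemma smx_clifford : clifford_group (qop1 smx).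
Proof.
apply: qop1_clifford => [||x z]; rewrite ?smx_adj ?smx4 //.
exists ('i ^+ x), x, (z + x); rewrite smx_sigma; split=> //.
by rewrite -exprM mulnC exprM i4 expr1n.
Qed.

Lemma zmx_clifford : clifford_group (qop1 (pauliZ C)).
Proof.
have za : (pauliZ C) ^t* = pauliZ C.
  apply/matrixP=> a b; rewrite !mxE; case: (I2P a) => ->; case: (I2P b) => ->;
  by rewrite /= ?mul0r ?mul1r ?conjC0 ?expr0 ?expr1 ?rmorphN1 ?conjC1.
apply: qop1_clifford => [||x z]; rewrite ?za ?pauliZK ?mulmx1 //.
exists ((-1) ^+ x), x, z; split.
  by rewrite -exprM mulnC exprM (exprM _ 2 2) sqrrN !expr1n.
apply/matrixP=> a b; rewrite mulmx2 [RHS]mxE mulmx2 !mxE.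
by case: (I2P a) => ->; case: (I2P b) => ->; case: (F2P x) => ->; case: (F2P z) => ->;
   rewrite /= ?expr0 ?expr1; ring.
Qed.

Definition czop : qop C 2 :=
  \matrix_(a, b) ((a == b)%:R * (-1) ^+ ((enum_val a : bits 2) 0%R * (enum_val a : bits 2) 1%R)%N).

Lemma entry_cz (x y : bits 2) :
  entry czop x y = (x == y)%:R * (-1) ^+ (x 0%R * x 1%R)%N.
Proof. by rewrite /entry mxE !enum_rankK (inj_eq enum_rank_inj). Qed.

Lemma prod_I2 (F : 'I_2 -> C) : \prod_j F j = F 0 * F 1.
Proof. by rewrite big_ord_recl big_ord1; congr (F _ * F _); exact: val_inj. Qed.

Lemma sigmaE x z a b : sigma x z a b = if x == (a != b)%:R then (-1) ^+ (z * b)%N else 0.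
Proof.
rewrite mxE; case: (F2P x) => ->; case: (a != b); by rewrite ?mul1r ?mul0r.
Qed.

Lemma czop_mul_entry (A : qop C 2) x y :
  entry (czop *m A) x y = (-1) ^+ (x 0%R * x 1%R)%N * entry A x y.
Proof.
rewrite entry_mul (bigD1 x) //= entry_cz eqxx mul1r big1 ?addr0 // => t tx.
by rewrite entry_cz eq_sym (negbTE tx) !mul0r.
Qed.

Lemma mul_czop_entry (A : qop C 2) x y :
  entry (A *m czop) x y = entry A x y * (-1) ^+ (y 0%R * y 1%R)%N.
Proof.
rewrite entry_mul (bigD1 y) //= entry_cz eqxx mul1r big1 ?addr0 // => t ty.
by rewrite entry_cz (negbTE ty) mul0r mulr0.
Qed.

Lemma czop_pg (p : pauli 2) :
  czop *m pg p = (-1) ^+ (p 0%R 0%R * p 0%R 1%R)%N *: (pg (cz 0 1 p) *m czop).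
Proof.
apply: entry_ext => x y.
rewrite czop_mul_entry entry_scale mul_czop_entry !entry_tensor !prod_I2 !gateE !eqxx /=.
move: (x 0) (x 1) (y 0) (y 1) (p 0 0) (p 0 1) (p 1 0) (p 1 1) => a0 a1 b0 b1 x0 x1 z0 z1.
rewrite !sigmaE; case: eqP => [->|_]; last by rewrite !mul0r !mulr0.
case: eqP => [->|_]; last by rewrite !mulr0 mul0r mulr0.
by case: (I2P a0) => ->; case: (I2P b0) => ->; case: (I2P a1) => ->; case: (I2P b1) => ->;
  case: (F2P z0) => ->; case: (F2P z1) => ->; rewrite /= ?expr0 ?expr1; ring.
Qed.

Lemma czop_adj : czop ^t* = czop.
Proof.
apply: entry_ext => x y; rewrite entry_adj !entry_cz rmorphM /= rmorphXn rmorphN1 rmorph_nat.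
by rewrite eq_sym; case: eqP => [->|_]; rewrite ?mul0r.
Qed.

Lemma czopK : czop *m czop = 1%:M.
Proof.
apply: entry_ext => x y; rewrite czop_mul_entry entry_cz entry1.
by rewrite mulrCA -expr2 sqrr_sign mulr1.
Qed.

Lemma czop_unitary : czop \is unitarymx.
Proof. by apply/unitarymxP; rewrite czop_adj czopK. Qed.

Lemma czop_clifford : clifford_group czop.
Proof.
apply: cliffordP => [|p|]; rewrite ?czopK ?mulmx1 //; first exact: czop_unitary.
exists ((-1) ^+ (p 0%R 0%R * p 0%R 1%R)%N), (cz 0 1 p); split; last exact: czop_pg.
by rewrite -exprM mulnC exprM (exprM _ 2 2) sqrrN !expr1n.
Qed.

Lemma qop1_unitary u : u ^t* *m u = 1%:M -> qop1 u \is unitarymx.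
Proof.
move=> uu; apply/unitarymxP; rewrite tensor_adj [_ *m _]qop1_mul.
by have := mulmx1C uu => ->; exact: tensor1.
Qed.

End Gates.

(** * From symplectic circuits to algorithms *)

Section Implementation.
Local Open Scope sesquilinear_scope.
Variables (C : numClosedFieldType) (n : nat).
Implicit Types (A B U : qop C n) (p q : pauli n).

(** Stated for an arbitrary continuation, since [algorithm] is built from its end: [A] is applied
    before [next]. *)
Definition implements (k : nat) A := forall next : algorithm C n n,
  exists a : algorithm C n n, cz_complexity a = (cz_complexity next + k)%N /\
    forall P psi, output_prob P a psi = output_prob P next (A *m psi).

Lemma implements1 : implements 0 1%:M.
Proof. by move=> a; exists a; rewrite addn0; split=> // P psi; rewrite mul1mx. Qed.

Lemma implements_comp k l A B :
  implements k A -> implements l B -> implements (k + l) (B *m A).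
Proof.
move=> hA hB next; have [b [cb hb]] := hB next; have [a [ca ha]] := hA b.
exists a; split; first by rewrite ca cb addnAC addnA.
by move=> P psi; rewrite ha hb mulmxA.
Qed.

Lemma implements_clifford1 (v : 'I_n) (U : qop C 1) : clifford_group U ->
  implements 0 (act_on (fun=> v) U).
Proof. by move=> cU next; exists (Clifford1 v cU next); rewrite addn0. Qed.

Lemma implements_clifford2 (v w : 'I_n) (U : qop C 2) : v != w -> clifford_group U ->
  implements 1 (act_on (pair_of v w) U).
Proof. by move=> vw cU next; exists (Clifford2 vw cU next); rewrite addn1. Qed.

Definition hop (v : 'I_n) : qop C n := act_on (fun=> v) (qop1 (hmx C)).
Definition sop (v : 'I_n) : qop C n := act_on (fun=> v) (qop1 (smx C)).
Definition cop (v w : 'I_n) : qop C n := act_on (pair_of v w) (czop C).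

Lemma inj1 (v : 'I_n) : injective (fun _ : 'I_1 => v).
Proof. by move=> i j _; rewrite (ord1 i) (ord1 j). Qed.

Lemma inj2 (v w : 'I_n) : v != w -> injective (pair_of v w).
Proof.
move=> vw i j; rewrite /pair_of; case: (I2P i) => ->; case: (I2P j) => -> //= e.
  by case/eqP: vw.
by case/eqP: vw.
Qed.

Lemma codom1 (v j : 'I_n) : j \notin codom (fun _ : 'I_1 => v) -> j != v.
Proof. by apply: contraNneq => ->; apply/codomP; exists 0. Qed.

Lemma hop_pg v p : exists c, hop v *m pg C p = c *: (pg C (had v p) *m hop v).
Proof.
exists ((-1) ^+ (p 0%R v * p 1%R v)%N); apply: act_on_tensor; first exact: inj1.
  by move=> j /codom1/negbTE jv; rewrite !gateE jv.
rewrite !gateE !eqxx -!/(qop1 _) !qop1_mul hmx_sigma qop1_scale //.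
Qed.

Lemma sop_pg v p : exists c, sop v *m pg C p = c *: (pg C (phase v p) *m sop v).
Proof.
exists ('i ^+ (p 0%R v)); apply: act_on_tensor; first exact: inj1.
  by move=> j /codom1/negbTE jv; rewrite !gateE jv.
rewrite !gateE !eqxx -!/(qop1 _) !qop1_mul smx_sigma qop1_scale //.
Qed.

Lemma cop_pg v w p : v != w ->
  exists c, cop v w *m pg C p = c *: (pg C (cz v w p) *m cop v w).
Proof.
move=> vw; exists ((-1) ^+ (p 0%R v * p 0%R w)%N).
apply: act_on_tensor; first exact: inj2.
  move=> j jc; have jv : j != v by apply: contraNneq jc => ->; apply/codomP; exists 0.
  have jw : j != w by apply: contraNneq jc => ->; apply/codomP; exists 1.
  by rewrite !gateE (negbTE jv) (negbTE jw).
have wv : w == v = false by apply/negbTE; rewrite eq_sym.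
pose p' : pauli 2 := mkp (fun i => p 0 (pair_of v w i)) (fun i => p 1 (pair_of v w i)).
have := czop_pg C p'; rewrite !mkp0 /= => e.
have -> : tensor (fun i => sigma C (p 0 (pair_of v w i)) (p 1 (pair_of v w i))) = pg C p'.
  by apply: eq_tensor => i; rewrite !(mkp0, mkp1).
have -> : tensor (fun i => sigma C (cz v w p 0 (pair_of v w i)) (cz v w p 1 (pair_of v w i)))
  = pg C (cz 0 1 p').
  apply: eq_tensor => i; rewrite !gateE !(mkp0, mkp1).
  by case: (I2P i) => ->; rewrite /= ?eqxx ?wv.
exact: e.
Qed.

(** [U] runs the circuit backwards, so it conjugates [f p] to [p] up to phase: when [f p] is Z-type
    and fixes the zero state, [p] stabilizes the output of [U] up to a scalar. *)
Lemma circuit_implements (S : {set 'I_n}) k f : circuit S k f ->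
  exists U, [/\ U \is unitarymx, implements k U &
    forall p, exists c, U *m pg C (f p) = c *: (pg C p *m U)].
Proof.
elim=> [|{}k {}f u uA _ [U [uU iU hU]]|{}k {}f u uA _ [U [uU iU hU]]|
         {}k {}f u w uA wA uw _ [U [uU iU hU]]].
- exists 1%:M; split; [| exact: implements1 |].
    by apply/unitarymxP; rewrite trmx1 map_mx1 mulmx1.
  by move=> p; exists 1; rewrite id_lfunE mul1mx mulmx1 scale1r.
- exists (hop u *m U); split.
  + apply: mul_unitarymx => //; apply: act_on_unitary; first exact: inj1.
    by apply: qop1_unitary; rewrite hmx_adj hmxK.
  + by rewrite -[k]addn0; apply: implements_comp => //; apply: implements_clifford1; exact: hmx_clifford.
  + move=> p; rewrite comp_lfunE; have [c e] := hU (had u p); have [d e'] := hop_pg u (had u p).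
    exists (c * d); rewrite -mulmxA e -scalemxAr [X in _ *: X]mulmxA e' hadK -scalemxAl scalerA.
    by rewrite -mulmxA.
- exists (sop u *m U); split.
  + apply: mul_unitarymx => //; apply: act_on_unitary; first exact: inj1.
    by apply: qop1_unitary; rewrite smx_adj.
  + by rewrite -[k]addn0; apply: implements_comp => //; apply: implements_clifford1; exact: smx_clifford.
  + move=> p; rewrite comp_lfunE; have [c e] := hU (phase u p); have [d e'] := sop_pg u (phase u p).
    exists (c * d); rewrite -mulmxA e -scalemxAr [X in _ *: X]mulmxA e' phaseK -scalemxAl scalerA.
    by rewrite -mulmxA.
- exists (cop u w *m U); split.
  + apply: mul_unitarymx => //; apply: act_on_unitary; first exact: inj2.
    exact: czop_unitary.
  + by rewrite -addn1; apply: implements_comp => //; apply: implements_clifford2 => //; exact: czop_clifford.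
  + move=> p; rewrite comp_lfunE; have [c e] := hU (cz u w p); have [d e'] := cop_pg (cz u w p) uw.
    exists (c * d); rewrite -mulmxA e -scalemxAr [X in _ *: X]mulmxA e' czK -scalemxAl scalerA.
    by rewrite -mulmxA.
Qed.

Lemma act_on_qop1 (v : 'I_n) (u : 'M[C]_2) :
  act_on (fun=> v) (qop1 u) = tensor (fun w => if w == v then u else 1%:M).
Proof.
apply: entry_ext => x y; rewrite entry_act_on entry_tensor (bigD1 v) //= eqxx.
rewrite entry_tensor big_ord1 !ffunE; case: (agreeP _ x y) => h.
  rewrite big1 ?mulr1 // => j jv; rewrite (negbTE jv) mxE h ?eqxx //.
  by apply/codomP=> -[i e]; move: jv; rewrite e eqxx.
have [j [jv xj]] : exists j, j != v /\ x j != y j.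
  apply: contrapT => no; apply: h => j jc.
  apply/eqP/negP => /negP xj; apply: no; exists j; split=> //; exact: codom1 jc.
by rewrite (bigD1 j) //= (negbTE jv) mxE (negbTE xj) mul0r mulr0.
Qed.

Definition zflip (s : pred 'I_n) : qop C n :=
  tensor (fun w => if s w then pauliZ C else 1%:M).

Lemma implements_zflip (s : seq 'I_n) : uniq s -> implements 0 (zflip (mem s)).
Proof.
elim: s => [_|v s IH /= /andP[vs us]].
  rewrite (_ : zflip _ = 1%:M); first exact: implements1.
  by rewrite -tensor1; apply: eq_tensor.
have -> : zflip (mem (v :: s)) = zflip (mem s) *m act_on (fun=> v) (qop1 (pauliZ C)).
  rewrite act_on_qop1 tensor_mul; apply: eq_tensor => w; rewrite /= inE.
  by case: eqP => [->|_]; rewrite ?(negbTE vs) /= ?mul1mx ?mulmx1.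
apply: (implements_comp (k := 0) (l := 0)); last exact: IH.
by apply: implements_clifford1; exact: zmx_clifford.
Qed.

Lemma zflip_unitary s : zflip s \is unitarymx.
Proof.
have za : (pauliZ C) ^t* = pauliZ C.
  apply/matrixP=> a b; rewrite !mxE; case: (I2P a) => ->; case: (I2P b) => ->;
  by rewrite /= ?mul0r ?mul1r ?conjC0 ?expr0 ?expr1 ?rmorphN1 ?conjC1.
apply/unitarymxP; rewrite tensor_adj tensor_mul -[RHS]tensor1; apply: eq_tensor => w.
by case: (s w); rewrite ?za ?pauliZK // trmx1 map_mx1 mulmx1.
Qed.

Lemma sqnormE (psi : qstate C n) : sqnorm psi = (psi ^t* *m psi) 0 0.
Proof.
rewrite /sqnorm mxE; apply: eq_bigr => i _.
rewrite !mxE normCKC.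
by have -> : (0 : 'I_1) = ord0 by apply: val_inj.
Qed.

Lemma sqnorm_unitary U (psi : qstate C n) : U \is unitarymx -> sqnorm (U *m psi) = sqnorm psi.
Proof.
move=> uU; rewrite !sqnormE trmx_mul map_mxM -mulmxA (mulmxA (U ^t*)).
by have := mulmx1C (unitarymxP uU) => ->; rewrite mul1mx.
Qed.

Lemma sqnorm_ket0 : sqnorm (ket0 C n) = 1.
Proof.
rewrite /sqnorm (bigD1 (enum_rank ([ffun=> ord0] : bits n))) //= mxE enum_rankK eqxx.
rewrite normr1 expr1n big1 ?addr0 // => i ir; rewrite mxE.
case: eqP => [e|_]; last by rewrite normr0 expr0n.
by case/eqP: ir; rewrite -e enum_valK.
Qed.

Lemma pg_ket0 p : (forall v, p 0 v = 0) -> pg C p *m ket0 C n = ket0 C n.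
Proof.
move=> px; apply/matrixP=> i j; rewrite mxE sum_bits.
rewrite (bigD1 ([ffun=> ord0] : bits n)) //= [X in _ + X]big1 ?addr0; last first.
  by move=> y /negbTE y0; rewrite [ket0 _ _ _ _]mxE enum_rankK y0 mulr0.
rewrite [ket0 _ _ (enum_rank _) _]mxE enum_rankK eqxx mulr1.
rewrite [RHS]mxE -{1}(enum_valK i) -/(entry _ _ _) entry_tensor.
case: eqP => [->|ne]; first by rewrite big1 // => v _; rewrite sigmaE px !ffunE eqxx muln0.
have [v xv] : exists v, (enum_val i : bits n) v != ord0.
  apply/existsP; rewrite -negb_forall; apply/negP=> /forallP h; apply: ne.
  by apply/ffunP=> v; rewrite ffunE; exact/eqP.
by rewrite (bigD1 v) //= sigmaE px ffunE xv mul0r.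
Qed.

End Implementation.

(** * Preparing the graph state *)

Section GraphState.
Local Open Scope sesquilinear_scope.
Variables (C : numClosedFieldType) (n : nat) (G : sgraph 'I_n).

Lemma graph_stabilizerE v : graph_stabilizer C G v = pg C (stab G v).
Proof.
apply: eq_tensor => w; rewrite mkp0 mkp1; case: eqP => [->|_].
  by rewrite adj_irr -sigma10.
by case: (G v w); rewrite ?sigma01 ?sigma00.
Qed.

Lemma gstab_sq v : graph_stabilizer C G v *m graph_stabilizer C G v = 1%:M.
Proof.
rewrite tensor_mul -tensor1; apply: eq_tensor => w; case: eqP => _; last first.
  by case: (G v w); rewrite ?pauliZK ?mulmx1.
apply/matrixP=> a b; rewrite mulmx2 !mxE.
by case: (I2P a) => ->; case: (I2P b) => ->; rewrite /= ?mul0r ?mul1r ?add0r ?addr0.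
Qed.

(** The generator at [v] has its only X at [v], so a Z there reverses the sign of this generator and
    of no other. *)
Lemma stabilizer_zflip (s : pred 'I_n) v :
  graph_stabilizer C G v *m zflip C s =
  (if s v then -1 else 1) *: (zflip C s *m graph_stabilizer C G v).
Proof.
rewrite !tensor_mul.
have -> : (if s v then -1 else 1 : C) = \prod_w (if w == v then if s v then -1 else 1 else 1).
  by rewrite (bigD1 v) //= eqxx big1 ?mulr1 // => w /negbTE ->.
rewrite -tensor_scale; apply: eq_tensor => w; case: eqP => [->|_]; last first.
  by rewrite scale1r; case: (G v w); case: (s w); rewrite ?mulmx1 ?mul1mx.
case: (s v); last by rewrite scale1r mulmx1 mul1mx.
apply/matrixP=> a b; rewrite mulmx2 [RHS]mxE mulmx2 !mxE.
by case: (I2P a) => ->; case: (I2P b) => ->; rewrite /= ?expr0 ?expr1; ring.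
Qed.

Lemma circuit_generates (A : {set 'I_n}) k f : circuit A k f ->
  (forall v w, f (stab G v) 0 w = 0) ->
  exists s (a : algorithm C n (n + s)), generates a G /\ cz_complexity a = k.
Proof.
move=> cf hf; exists 0%N.
suff [a [ga ca]] : exists a : algorithm C n n,
    output_prob (graph_state G) a (ket0 C n) = 1 /\ cz_complexity a = k.
  (* The register has size [n + 0]; generalizing this index allows transport to [n]. *)
  move: (addn0 n) => e; rewrite /generates.
  move: (n + 0)%N e => N e; subst N; by exists a.
have [U [uU iU hU]] := circuit_implements C cf.
pose psi := U *m ket0 C n.
have psi1 : sqnorm psi = 1 by rewrite sqnorm_unitary // sqnorm_ket0.
have psi0 : psi != 0.
  apply/eqP=> e; move: psi1; rewrite e /sqnorm big1 => [/eqP|i _]; first by rewrite eq_sym oner_eq0.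
  by rewrite mxE normr0 expr0n.
have hv v : exists c : C, (c == 1) || (c == -1) /\ graph_stabilizer C G v *m psi = c *: psi.
  (* Applied to the zero state, [e] makes [psi] an eigenvector of the generator; as the generator
     squares to 1, the eigenvalue is a sign. *)
  have [c e] := hU (stab G v).
  have e1 : psi = c *: (graph_stabilizer C G v *m psi).
    by rewrite graph_stabilizerE mulmxA scalemxAl -e -mulmxA pg_ket0.
  have e2 : graph_stabilizer C G v *m psi = c *: psi.
    by rewrite {1}e1 -scalemxAr mulmxA gstab_sq mul1mx.
  exists c; split=> //; rewrite -sqrf_eq1 -subr_eq0.
  have : (c ^+ 2 - 1) *: psi = 0.
    by rewrite scalerBl scale1r expr2 -scalerA -e2 -e1 subrr.
  by move/eqP; rewrite scaler_eq0 (negbTE psi0) orbF.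
have [c hc] := fin_all_exists hv.
(* Z gates at the vertices with eigenvalue -1 repair all signs, at no CZ cost. *)
pose s := enum [pred v | c v != 1].
have iD : implements 0 (zflip C (mem s)) by apply: implements_zflip; exact: enum_uniq.
have [a [ca ha]] := implements_comp iU iD (Output C n).
exists a; split; last by rewrite ca add0n addn0.
have D1 : sqnorm (zflip C (mem s) *m psi) = 1.
  by rewrite sqnorm_unitary //; exact: zflip_unitary.
rewrite ha -mulmxA -/psi /= /normalize D1 sqrtC1 invr1 scale1r.
case: asboolP => // no; case: no; split=> // v.
rewrite mulmxA stabilizer_zflip -scalemxAl -mulmxA (hc v).2 -scalemxAr scalerA.
have -> : (mem s : pred _) v = (c v != 1) by rewrite -[LHS]/(v \in s) mem_enum inE.
case: (hc v) => /orP[]/eqP -> _; first by rewrite eqxx mulr1 scale1r.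
have -> : (-1 : C) != 1 by rewrite eq_sym -subr_eq0 opprK (_ : 1 + 1 = 2%:R) ?pnatr_eq0.
by rewrite mulrNN mulr1 scale1r.
Qed.

End GraphState.

(** * The bound *)

(** The infimum lies below r + 1, so some decomposition has width below r + 1; widths being natural
    numbers, it is at most r. *)
Lemma rankwidth_witness (R : realType) (V : finType) (G : sgraph V) r :
  (1 < #|V|)%N -> (rankwidth G R <= (r%:R)%:E)%E ->
  exists (U : finType) (T : sgraph U) (L : V -> U),
    is_rank_decomposition T L /\ (decomposition_width G T L <= r)%N.
Proof.
move=> V1; rewrite /rankwidth leqNgt V1 /= => le_r.
have : (min_nat R [set k | exists (U : finType) (T : sgraph U) (L : V -> U),
    is_rank_decomposition T L /\ decomposition_width G T L = k] < (r.+1%:R)%:E)%E.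
  by apply: le_lt_trans le_r _; rewrite lte_fin ltr_nat.
move=> /ereal_inf_lt[_ [k [U [T [L [dT wT]]]] <-]].
by rewrite lte_fin ltr_nat ltnS -wT => h; exists U, T, L.
Qed.

Lemma Gamma_CZ_le (R : realType) n (G : sgraph 'I_n) k (b : R) :
  solvable [set: 'I_n] k (gspace G) -> k%:R <= b -> (Gamma_CZ R G <= b%:E)%E.
Proof.
move=> [l [f [cf lk hf]]] kb.
have [s [a [ga ca]]] := @circuit_generates R[i] n G _ _ _ cf (fun v w => hf _ (stab_gspace G v) w).
apply: (@le_trans _ _ (l%:R)%:E).
  by apply: ereal_inf_lbound; exists l => //; exists s, a.
by rewrite lee_fin; apply: le_trans kb; rewrite ler_nat.
Qed.

Lemma Gamma_CZ_rankwidth (R : realType) (r n : nat) (G : sgraph 'I_n) (sigma c n0 : R) :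
  (0 < r)%N -> (rankwidth G R <= (r%:R)%:E)%E -> 1 <= n0 ->
  (forall m k, n0 <= m%:R -> m%:R <= n0 + r%:R ->
    (6 * k + 4 <= m ^ 2 + 3 * m)%N -> k%:R <= sigma * m%:R - c) ->
  (forall t, (t <= r)%N -> (r * t + (t * t) %/ 4)%:R <= sigma * t%:R) ->
  n0 <= n%:R -> (Gamma_CZ R G <= (sigma * n%:R - c)%:E)%E.
Proof.
move=> r0 hG n01 small block hn.
have UA : (gspace G <= supported [set: 'I_n])%VS.
  by apply/subvP=> p _; rewrite supported_suppP finset.subsetT.
have iU : isotropic (gspace G) by apply: isotropic_gspace; exact: adj_sym.
have cT : #|[set: 'I_n]| = n by rewrite cardsT card_ord.
have dU : (#|[set: 'I_n]| <= \dim (gspace G))%N by rewrite dim_gspace cT.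
have n_gt0 : (0 < n)%N by rewrite -(ltr_nat R); lra.
(* Inside the window the quadratic bound suffices; beyond it n is at least 2, so a
   rank-decomposition exists. *)
have [le_n|lt_n] := lerP n%:R (n0 + r%:R).
  have [|k [sk hk]] := solvable_generic UA iU dU; first by rewrite cT.
  by apply: (Gamma_CZ_le sk); apply: small => //; rewrite cT in hk.
have n1 : (1 < n)%N.
  have : (1 : R) <= r%:R by rewrite ler1n.
  by rewrite -(ltr_nat R); lra.
have [|U [T [L [[treeT deg3 _ L_inj leafP] wT]]]] := rankwidth_witness _ hG.
  by rewrite card_ord.
pose rho := L (Ordinal n_gt0).
pose F (X : {set 'I_n}) := exists x y, away T rho x y /\ X = cut T L x y.
have [||||k sk hk] :=
  @solvable_family n R r F sigma c n0 _ _ n01 small block [set: 'I_n] (gspace G) UA iU dU.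
- move=> X Y [x [y [axy ->]]] [x' [y' [axy' ->]]].
  exact: (cut_laminar treeT L axy axy').
- move=> A r_lt; have [z [az sub]] := leaf_cut treeT L_inj leafP (Ordinal n_gt0).
  have [|x [y [axy hxy]]] := side_balanced treeT deg3 L_inj leafP r0 az (A := A) (r := r).
    have le : (#|A :\ Ordinal n_gt0| <= #|cut T L z rho :&: A|)%N.
      apply: subset_leq_card; rewrite finset.subsetI finset.subsetDl andbT.
      by apply: (fintype.subset_trans _ sub); apply: finset.setSD; exact: finset.subsetT.
    suff h : (r < #|A :\ Ordinal n_gt0|)%N by exact: (leq_trans h le).
    have := cardsD1 (Ordinal n_gt0) A.
    move: r_lt => + e; rewrite e; case: (_ \in A); first by rewrite add1n ltnS.
    by rewrite add0n; exact: ltnW.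
  by exists (cut T L x y) => //; exists x, y.
- move=> X [x [y [[Txy _] ->]]]; rewrite finset.setIT.
  apply: leq_trans (dim_gspace_supported G (cut T L x y)) _; rewrite leq_add2l.
  apply: leq_trans wT.
  have h := @leq_bigmax_cond _ (fun e : U * U => T e.1 e.2)
    (fun e => edge_width G T L e.1 e.2) (x, y) Txy.
  exact: h.
- by rewrite cT.
by rewrite cT in hk; exact: Gamma_CZ_le sk hk.
Qed.

(* The line and the quadratic bound of the generic case cross at n0 and n0 + r. *)
Lemma generic_le_linear (R : realFieldType) (sigma c n0 r : R) (m k : nat) :
  (forall x, sigma * x - c - (x ^+ 2 + 3 * x - 4) / 6 = (x - n0) * (n0 + r - x) / 6) ->
  n0 <= m%:R -> m%:R <= n0 + r -> (6 * k + 4 <= m ^ 2 + 3 * m)%N ->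
  k%:R <= sigma * m%:R - c.
Proof.
move=> id_x h1 h2; rewrite -(ler_nat R) !natrD !natrM => hk.
have : 0 <= (m%:R - n0) * (n0 + r - m%:R) by rewrite mulr_ge0 // subr_ge0.
by have := id_x m%:R; lra.
Qed.

(** For t < r, floor(t^2/4) may be replaced by t^2/4, as r t is at most r^2 - 1. For t = r equality
    holds, and it needs the exact value (r^2 - 1)/4. *)
Lemma block_odd (r t : nat) : odd r -> (t <= r)%N ->
  (4 * r * (r * t + (t * t) %/ 4) <= (5 * (r * r) - 1) * t)%N.
Proof.
move=> ro tr; have q4 : (4 * ((t * t) %/ 4) <= t * t)%N by rewrite mulnC leq_trunc_div.
have [tr'|rt] := ltnP t r.
  by move: q4; move: (_ %/ 4)%N => q; nia.
have {rt tr} -> : t = r by apply/eqP; rewrite eqn_leq tr.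
have -> : r = (r./2 * 2).+1 by rewrite muln2 -[LHS]odd_double_half ro.
set s := r./2; have -> : ((s * 2).+1 * (s * 2).+1 = (s * s.+1) * 4 + 1)%N by nia.
by rewrite divnMDl // addn0; nia.
Qed.

Theorem theorem4 (R : realType) (r n : nat) (G : sgraph 'I_n)
    (hr : (1 <= r)%N) (hG : (rankwidth G R <= (r%:R)%:E)%E) :
  (odd r ->
   (13 * r%:R ^+ 2 - 6 * r%:R - 3) / (4 * r%:R) <= n%:R :> R ->
   (Gamma_CZ R G <=
    ((5 * r%:R ^+ 2 - 1) / (4 * r%:R) * n%:R
     - (221 * r%:R ^+ 4 - 180 * r%:R ^+ 3 + 10 * r%:R ^+ 2 + 36 * r%:R + 9)
       / (96 * r%:R ^+ 2))%:E)%E) /\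
  (~~ odd r ->
   (13 * r%:R - 6) / 4 <= n%:R :> R ->
   (Gamma_CZ R G <=
    (5 * r%:R / 4 * n%:R
     - (221 * r%:R ^+ 2 - 180 * r%:R + 100) / 96)%:E)%E).
Proof.
have r1 : 1 <= r%:R :> R by rewrite ler1n.
have r0 : r%:R != 0 :> R by apply: lt0r_neq0; lra.
have r4 : 0 < 4 * r%:R :> R by lra.
split=> ro hn; apply: (Gamma_CZ_rankwidth hr hG) hn.
(* Tight: the threshold is exactly 1 for r = 1. *)
- by rewrite ler_pdivlMr //; nra.
- by move=> m k; apply: generic_le_linear => x; field.
- move=> t /(block_odd ro); rewrite -(ler_nat R) => h.
  rewrite mulrAC ler_pdivlMr //; move: h.
  have rr : (1 <= 5 * (r * r))%N by move: hr; clear; nia.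
  by rewrite natrM (natrM _ _ t) (natrB _ rr) !natrM; lra.
- have r2 : (2 <= r)%N by move: hr ro; clear; case: r => [|[]].
  by move: r2; rewrite -(ler_nat R); lra.
- by move=> m k; apply: generic_le_linear => x; field.
- move=> t tr; have : (4 * (r * t + (t * t) %/ 4) <= 5 * r * t)%N.
    have q4 : (4 * ((t * t) %/ 4) <= t * t)%N by rewrite mulnC leq_trunc_div.
    by move: q4; move: (_ %/ 4)%N => q; nia.
  by rewrite -(ler_nat R) !natrM; lra.
Qed.
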